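(* Let $1\le r\le d$ be integers. Let $F(x)=\mathbb{E}_{\xi\sim\mathcal{D}}[f(x,\xi)]$, $F:\mathbb{R}^d\to\mathbb{R}$, be differentiable, bounded below with $F_*:=\inf_{x}F(x)>-\infty$, and $L$-smooth for some $L>0$, i.e. $\|\nabla F(x)-\nabla F(y)\|\le L\|x-y\|$ for all $x,y\in\mathbb{R}^d$. Assume the stochastic gradient is unbiased, $\mathbb{E}[\nabla f(x,\xi)]=\nabla F(x)$ for all $x\in\mathbb{R}^d$, and $\sigma$-sub-Gaussian for some $\sigma>0$: for all $x\in\mathbb{R}^d$ and all $\lambda\in\mathbb{R}$ with $|\lambda|\le 1/\sigma$, $$\mathbb{E}\left[\exp\left(\lambda^2\|\nabla f(x,\xi)-\nabla F(x)\|^2\right)\right]\le\exp(\lambda^2\sigma^2).$$ Let $T\ge 1$ be an integer, let $B>0$, $q>0$, $\bar B:=\lceil\max\{1,BT^q\}\rceil$, $\alpha:=24\sqrt{\tfrac{e(e+1)}{2}}$, $\bar\eta:=\frac{r}{Ld}$, and let $\{x_k\}_{k\ge0}$ be generated from $x_0\in\mathbb{R}^d$ by RS-SGD with stepsize $\bar\eta$ and minibatch size $\bar B$. Put $\Delta_0:=F(x_0)-F_*$ and $$\mu:=\begin{cases}1-I_{\frac{r}{2d}}\left(\frac r2,\frac{d-r}{2}\right), & r<d,\\ 1,& r=d,\end{cases}$$ where $I_x(a,b)$ is the regularized incomplete Beta function. Then for any $\delta\in(0,1)$ such that $2\log(2/\delta)<\mu T$, with probability at least $1-\delta$, $$\min_{0\le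 k\le T-1}\|\nabla F(x_k)\|^2\le\frac{4L\frac dr\Delta_0}{\mu T-\sqrt{2\mu T\log\frac2\delta}}+\frac{2\frac dr\left(\frac{\alpha^2\sigma^2}{\bar B}\right)(d\log5+1)}{\mu-\sqrt{2\frac{\mu}{T}\log\frac2\delta}}+\frac{2\frac dr\left(\frac{\alpha^2\sigma^2}{\bar B}\right)\log\frac2\delta}{\mu T-\sqrt{2\mu T\log\frac2\delta}}.$$
   Context: $\|\cdot\|$ is the Euclidean norm. $\nabla f(x,\xi)$ denotes the gradient in $x$ (assumed to exist and be jointly measurable). Haar matrix: a random $d\times r$ matrix $P$ equal to $\sqrt{d/r}$ times the first $r$ columns of a Haar-distributed random orthogonal matrix in $O(d)$. Thus $UP$ has the same law as $P$ for every $U\in O(d)$, $\mathbb{E}[PP^\top]=I_d$, $P^\top P=\frac dr I_r$, and $\|P^\top x\|>0$ almost surely for each fixed $x\neq0$. RS-SGD (randomized subspace SGD): $x_0$ is deterministic; at iteration $k=0,1,\dots$ one draws a Haar matrix $P_k\in\mathbb{R}^{d\times r}$ and i.i.d. samples $\xi_k^1,\dots,\xi_k^{\bar B}\sim\mathcal{D}$, all independent of each other and of the past iterations, sets $g_k=\frac1{\bar B}\sum_{j=1}^{\bar B}\nabla f(x_k,\xi_k^j)$, and updates $x_{k+1}=x_k-\bar\eta P_kP_k^\top g_k$. The regularized incomplete Beta function $I_x(a,b)$ is the cumulative distribution function at $x$ of the Beta$(a,b)$ distribution. *)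

(* Defs.v *)
From HB Require Import structures.
From mathcomp Require Import all_boot all_order all_algebra.
From mathcomp Require Import finmap.
From mathcomp Require Import all_classical all_reals all_analysis.

Set Implicit Arguments.
Unset Strict Implicit.
Unset Printing Implicit Defensive.

Import Order.TTheory GRing.Theory Num.Theory.
Import numFieldNormedType.Exports.

Local Open Scope classical_set_scope.
Local Open Scope ring_scope.

(* The sigma-algebra generated by the entries; for real matrices this is the
   Borel sigma-algebra. *)
Definition mx_cylinders d (T : measurableType d) (m n : nat) :
    set (set 'M[T]_(m, n)) :=
  [set C | exists i j, exists2 B : set T,
    measurable B & C = [set M : 'M[T]_(m, n) | B (M i j)]].

Definition measure_mx_display : measure_display -> measure_display.
Proof. exact. Qed.

Section measurable_mx.
Context d (T : measurableType d) (m n : nat).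

Let mx_set0 : <<s @mx_cylinders d T m n >> set0.
Proof. exact: sigma_algebra0. Qed.

Let mx_setC A :
  <<s @mx_cylinders d T m n >> A -> <<s @mx_cylinders d T m n >> (~` A).
Proof. exact: sigma_algebraC. Qed.

Let mx_bigcup (F : (set _)^nat) : (forall i, <<s @mx_cylinders d T m n >> (F i)) ->
  <<s @mx_cylinders d T m n >> (\bigcup_i (F i)).
Proof. exact: sigma_algebra_bigcup. Qed.

HB.instance Definition _ := @isMeasurable.Build (measure_mx_display d)
  'M[T]_(m, n) <<s @mx_cylinders d T m n >> mx_set0 mx_setC mx_bigcup.

End measurable_mx.

Section euclidean.
Context {R : realType}.

(* The library's norm on matrices is the sup norm. *)
Definition enorm n (v : 'cV[R]_n) : R := Num.sqrt (\sum_i v i 0 ^+ 2).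

Definition gradient n (F : 'cV[R]_n -> R) (x : 'cV[R]_n) : 'cV[R]_n :=
  \col_i 'D_(delta_mx i 0) F x.

Definition smooth n (L : R) (F : 'cV[R]_n -> R) : Prop :=
  forall x y, enorm (gradient F x - gradient F y) <= L * enorm (x - y).

End euclidean.

Section incomplete_beta.
Context {R : realType}.

(* The library's beta distribution only has natural number parameters. *)
Definition beta_kernel (a b t : R) : R := t `^ (a - 1) * (1 - t) `^ (b - 1).

Definition beta_law (a b : R) (A : set R) : R :=
  (\int[lebesgue_measure]_(t in A `&` `]0, 1[) beta_kernel a b t) /
  (\int[lebesgue_measure]_(t in `]0, 1[) beta_kernel a b t).

Definition reg_incomplete_beta (x a b : R) : R := beta_law a b `]-oo, x].

End incomplete_beta.

Section independence.
Context d (Omega : measurableType d) (R : realType) (Pr : probability Omega R).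

Definition mutually_independent (I : choiceType)
    (G : I -> set (set Omega)) : Prop :=
  forall (J : {fset I}) (E : I -> set Omega),
    (forall i, i \in J -> G i (E i)) ->
    Pr (\bigcap_(i in [set` J]) E i) = (\prod_(i <- J) Pr (E i))%E.

Definition sigma_of d' (T : measurableType d') (X : Omega -> T) :
    set (set Omega) := preimage_set_system setT X measurable.

(* Equality of measures is only required on measurable sets. *)
Definition has_law d' (T : measurableType d') (X : {RV Pr >-> T})
    (nu : set T -> \bar R) : Prop :=
  forall A, measurable A -> distribution Pr X A = nu A.

End independence.

Section haar.
Context {R : realType}.

Definition orthogonal_group (n : nat) : set 'M[R]_n :=
  [set U | U^T *m U = 1%:M].

Definition is_haar_orthogonal n (nu : probability 'M[R]_n R) : Prop :=
  nu (@orthogonal_group n) = 1%E /\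
  forall U, orthogonal_group U ->
    forall A, measurable A -> nu (mulmx U @^-1` A) = nu A.

Definition scaled_first_cols d r (le_rd : (r <= d)%N) (Q : 'M[R]_d) :
    'M[R]_(d, r) :=
  Num.sqrt (d%:R / r%:R) *: colsub (widen_ord le_rd) Q.

(* The Haar-distributed orthogonal matrix need not live on the same probability
   space: only the law of X matters. *)
Definition is_haar_matrix d' (Omega : measurableType d')
    (Pr : probability Omega R) d r (le_rd : (r <= d)%N)
    (X : {RV Pr >-> 'M[R]_(d, r)}) : Prop :=
  exists2 nu : probability 'M[R]_d R, is_haar_orthogonal nu &
    has_law X (pushforward nu (scaled_first_cols le_rd)).

End haar.

Section stochastic_gradient.
Context {R : realType} d' (Xi : measurableType d') (D : probability Xi R).
Context (d : nat).
Implicit Types (f : 'cV[R]_d -> Xi -> R) (F : 'cV[R]_d -> R).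

Definition sgrad f (x : 'cV[R]_d) (z : Xi) : 'cV[R]_d := gradient (f ^~ z) x.

Definition is_objective f F : Prop :=
  forall x, D.-integrable setT (EFin \o f x) /\ ('E_D[f x] = (F x)%:E)%E.

Definition unbiased f F : Prop :=
  forall x i, D.-integrable setT (fun z => (sgrad f x z i 0)%:E) /\
    ('E_D[(fun z => sgrad f x z i 0)%R] = (gradient F x i 0)%R%:E)%E.

Definition sub_gaussian (sigma : R) f F : Prop :=
  forall x (lambda : R), `|lambda| <= 1 / sigma ->
    ('E_D[(fun z => expR (lambda ^+ 2 *
             enorm (sgrad f x z - gradient F x) ^+ 2))%R]
     <= (expR (lambda ^+ 2 * sigma ^+ 2))%R%:E)%E.

End stochastic_gradient.

Section rs_sgd.
Context {R : realType} d1 (Omega : measurableType d1) (Pr : probability Omega R).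
Context d2 (Xi : measurableType d2) (D : probability Xi R).
Context (d r b : nat).

Definition rs_sgd_sigma (P : nat -> Omega -> 'M[R]_(d, r))
    (xi : nat -> 'I_b -> Omega -> Xi) (i : nat + nat * 'I_b) :
    set (set Omega) :=
  match i with
  | inl k => sigma_of (P k)
  | inr (k, j) => sigma_of (xi k j)
  end.

(* Since the iterate x_k is a function of the draws at iterations < k, joint
   independence of all the draws includes their independence of the past. *)
Definition rs_sgd_draws (le_rd : (r <= d)%N)
    (P : nat -> {RV Pr >-> 'M[R]_(d, r)})
    (xi : nat -> 'I_b -> {RV Pr >-> Xi}) : Prop :=
  [/\ forall k, is_haar_matrix le_rd (P k),
      forall k j, has_law (xi k j) D
    & mutually_independent Pr
        (rs_sgd_sigma (fun k => P k : Omega -> _)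
                      (fun k j => xi k j : Omega -> _))].

Definition minibatch_grad (f : 'cV[R]_d -> Xi -> R) (x : 'cV[R]_d)
    (z : 'I_b -> Xi) : 'cV[R]_d :=
  b%:R^-1 *: \sum_(j < b) sgrad f x (z j).

Fixpoint rs_sgd (f : 'cV[R]_d -> Xi -> R) (eta : R) (x0 : 'cV[R]_d)
    (P : nat -> Omega -> 'M[R]_(d, r)) (xi : nat -> 'I_b -> Omega -> Xi)
    (k : nat) (w : Omega) : 'cV[R]_d :=
  if k is k'.+1 then
    let x := rs_sgd f eta x0 P xi k' w in
    x - eta *: (P k' w *m (P k' w)^T *m minibatch_grad f x (fun j => xi k' j w))
  else x0.

End rs_sgd.

Section constants.
Context {R : realType}.

Definition minibatch_size (B q : R) (T : nat) : nat :=
  absz (Num.ceil (Num.max 1 (B * T%:R `^ q))%R).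

Definition alpha : R := 24 * Num.sqrt (expR 1 * (expR 1 + 1) / 2).

Definition mu_const (d r : nat) : R :=
  if (r < d)%N then
    1 - reg_incomplete_beta (r%:R / (2 * d%:R)) (r%:R / 2) ((d%:R - r%:R) / 2)
  else 1.

End constants.

(* Main.v *)
(* Haar invariance forces [|Q^T v|^2], for the first [r] columns [Q] of a Haar orthogonal matrix and
   a unit vector [v], to have the moments of the Beta distribution with parameters [r / 2] and
   [(d - r) / 2]: these moments depend on [v] only through its norm, and expanding them at
   [v + s e_i] to second order in [s] and summing over [i] gives a recursion.  Polynomials
   approximating a step function then compare the distribution functions, so that each iteration
   satisfies [|P_k^T grad F(x_k)|^2 >= |grad F(x_k)|^2 / 2] with conditional probability at least
   [mu].  A Chernoff bound over the [T] iterations shows that, outside an event of probability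
   [delta / 2], at least [mu T - sqrt (2 mu T log (2 / delta))] iterations are of this kind.

   On the other side, one step of the method decreases [F] by at least
   [|P_k^T grad F(x_k)|^2 / (2 L d / r) - |g_k - grad F(x_k)|^2 / (2 L)].  Conditioning on the past
   sample after sample bounds the exponential moment of the sum of the squared minibatch errors,
   hence that sum outside another event of probability [delta / 2].
   Summing the descent inequalities over the iterations of the first kind gives the bound. *)

Require Import Defs.
From HB Require Import structures.
From mathcomp Require Import all_boot all_order all_algebra.
From mathcomp Require Import finmap.
From mathcomp Require Import all_classical all_reals all_analysis.
From mathcomp Require Import measurable_realfun.
From mathcomp Require Import ring lra.

Set Implicit Arguments.
Unset Strict Implicit.
Unset Printing Implicit Defensive.

Import Order.TTheory GRing.Theory Num.Theory.
Import numFieldNormedType.Exports.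

Local Open Scope classical_set_scope.
Local Open Scope ring_scope.

(** * Conditioning on an independent past *)

(** The Beta law has to come out of left invariance alone, which is all that [is_haar_orthogonal]
    states beyond concentration on the group; hence the detour through moments. A one-sided
    comparison at the single point [r / (2 d)] suffices, so no uniqueness theorem for the moment
    problem is invoked. The scaling [d / r] turns this point into the factor 1/2. The gradients at
    the iterates depend on all earlier draws, so neither the alignment events nor the minibatch
    errors are claimed to be independent across iterations. Both exponential moments are built by
    induction, one fresh draw at a time, with the past frozen. The exponential moment of the squared
    norm of a sum does not factor over the samples. Keeping the exponent in the form
    [|v|^2 / (sigma^2 K)] and raising [K] by 16 at each sample absorbs the cross term. Starting from
    [K = (alpha^2 - 16) b], the [b] samples of an iteration lead to [alpha^2 b], whence the factor
    [alpha^2 sigma^2 / b] after averaging. *)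

Section past_independence.
Context d (Omega : measurableType d) (R : realType) (Pr : probability Omega R).
Context (I : choiceType) (G : I -> set (set Omega)).
Hypothesis mG : forall i, G i `<=` measurable.
Hypothesis GI : forall i, setI_closed (G i).
Hypothesis indG : mutually_independent Pr G.

(** A pi-system generating the sigma-algebra of the families [G i] with [i] in [J]. *)
Let cyl (J : set I) : set (set Omega) :=
  [set A | exists (K : {fset I}) (E : I -> set Omega),
     (forall i, i \in K -> J i /\ G i (E i)) /\ A = \bigcap_(i in [set` K]) E i].

Let cyl_measurable J : cyl J `<=` measurable.
Proof.
move=> _ [K [E [KE ->]]]; apply: fin_bigcap_measurable => // i /= iK.
by apply: mG; apply: (KE _ iK).2.
Qed.

Let cylI J : setI_closed (cyl J).
Proof.
move=> _ _ [K [E [KE ->]]] [K' [E' [KE' ->]]].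
exists (K `|` K')%fset.
(* Padding by [setT] outside [K] or [K'] does not require [setT] in [G i]: each index of the union
   keeps at least one genuine event. *)
exists (fun i => (if i \in K then E i else setT) `&`
                 (if i \in K' then E' i else setT)).
split => [i|].
  rewrite inE; case: (boolP (i \in K)) => /= iK; case: (boolP (i \in K')) => //= iK' _.
  - by split; [exact: (KE _ iK).1|apply: GI; [exact: (KE _ iK).2|exact: (KE' _ iK').2]].
  - by rewrite setIT; exact: KE.
  - by rewrite setTI; exact: KE'.
apply/seteqP; split => [w [h h'] i /= _|w h].
  split; first by case: ifP => // iK; exact: h.
  by case: ifP => // iK; exact: h'.
split=> i /= iK.
  have := h i; rewrite /= inE iK /= => /(_ isT)[+ _]; exact.
have := h i; rewrite /= inE iK orbT /= => /(_ isT)[_ +]; exact.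
Qed.

Let cyl_indep J i0 A B : ~ J i0 -> cyl J A -> G i0 B ->
  Pr (A `&` B) = (Pr A * Pr B)%E.
Proof.
move=> Ji0 [K [E [KE ->]]] GB.
have i0K : i0 \notin K by apply/negP => /KE[].
pose E' i := if i == i0 then B else E i.
have E'K i : i \in K -> E' i = E i.
  by rewrite /E'; case: eqP => // -> /KE[].
have := indG (J := (i0 |` K)%fset) (E := E').
rewrite big_fsetU1//=.
have E'0 : E' i0 = B by rewrite /E' eqxx.
have -> : \bigcap_(i in [set` (i0 |` K)%fset]) E' i =
    \bigcap_(i in [set` K]) E i `&` B.
  apply/seteqP; split => [w h|w [h wB] i /=].
    split=> [i /= iK|].
      by have := h i; rewrite /= !inE iK orbT E'K//; exact.
    by have := h i0; rewrite /= !inE eqxx /E' eqxx; exact.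
  by rewrite !inE /E'; case: eqP => //= _ iK; exact: h.
move=> ->; last first.
  move=> i; rewrite !inE /E'; case: eqP => [-> //|_ /= iK].
  by exact: (KE _ iK).2.
rewrite indG => [|i /KE[]//].
rewrite muleC; congr (_ * _)%E.
  rewrite big_seq [RHS]big_seq.
  by apply: eq_bigr => i iK; rewrite E'K.
by rewrite E'0.
Qed.

(** For fixed [B], the events independent of [B] form a Dynkin system, which contains the pi-system
    [cyl J]. *)
Lemma past_independent (J : set I) i0 A B : ~ J i0 ->
  <<s \bigcup_(i in J) G i >> A -> G i0 B -> Pr (A `&` B) = (Pr A * Pr B)%E.
Proof.
move=> Ji0 sA GB; have mB := mG GB.
suff H : <<s cyl J >> `<=` [set A | measurable A /\ Pr (A `&` B) = (Pr A * Pr B)%E].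
  suff : <<s cyl J >> A by move=> /H[].
  move: A sA; apply: smallest_sub; first exact: smallest_sigma_algebra.
  move=> A [i Ji GA]; apply: sub_sigma_algebra; exists [fset i]%fset, (fun=> A).
  split=> [j|]; first by rewrite inE => /eqP ->.
  by rewrite set_fset1 bigcap_set1.
apply: lambda_system_subset => //; last by move=> C CC; split;
  [exact: cyl_measurable CC|exact: cyl_indep Ji0 CC GB].
apply/dynkin_lambda_system; split.
- by split => //; rewrite setTI probability_setT mul1e.
- move=> C [mC CB]; split; first exact: measurableC.
  have e : Pr B = (Pr (~` C `&` B) + Pr C * Pr B)%E.
    by rewrite -CB setIC -setDE [C `&` B]setIC; exact: measureDI.
  rewrite probability_setC// muleBl ?fin_num_measure//.
  by rewrite mul1e [X in (X - _)%E]e addeK// fin_numM// fin_num_measure.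
- move=> F tF HF; have mF n : measurable (F n) by have [] := HF n.
  split; first exact: bigcup_measurable.
  rewrite setI_bigcupl !measure_bigcup//; last 2 first.
    by move=> n _; exact: measurableI.
    exact: trivIset_setIr.
  rewrite -(fineK (fin_num_measure Pr _ mB)) muleC -nneseriesZl//.
  by apply: eq_eseriesr => n _; rewrite fineK ?fin_num_measure// muleC; exact: (HF n).2.
Qed.

End past_independence.

Section conditioning.
Local Open Scope ereal_scope.
Context d (Omega : measurableType d) (R : realType) (Pr : probability Omega R).

(** Independence identifies the joint law with the product of the laws; Tonelli does the rest. *)
Lemma integral_indep_pair d1 d2 (S : measurableType d1) (T : measurableType d2)
    (X : {RV Pr >-> S}) (Y : {RV Pr >-> T}) (h : S * T -> \bar R) :
  (forall A B, measurable A -> measurable B ->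
    Pr (X @^-1` A `&` Y @^-1` B) = Pr (X @^-1` A) * Pr (Y @^-1` B)) ->
  measurable_fun setT h -> (forall p, 0 <= h p) ->
  \int[Pr]_w h (X w, Y w) = \int[Pr]_w \int[distribution Pr Y]_y h (X w, y).
Proof.
move=> indXY mh h0.
have mXY : measurable_fun setT (fun w => (X w, Y w)).
  by apply/measurable_fun_pair; exact: measurable_funPT.
pose XY : {RV Pr >-> (S * T)%type} :=
  HB.pack (fun w => (X w, Y w)) (isMeasurableFun.Build _ _ _ _ _ mXY).
transitivity (\int[distribution Pr XY]_p h p).
  by rewrite ge0_integral_distribution.
transitivity (\int[distribution Pr X \x distribution Pr Y]_p h p).
  apply: eq_measure_integral => A mA _; apply/esym.
  by apply: product_measure_unique => //= B C mB mC; exact: indXY.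
rewrite fubini_tonelli1// ge0_integral_distribution//.
- exact: measurable_fun_fubini_tonelli_F.
- by move=> y; exact: integral_ge0.
Qed.

(** Replaces conditional expectations throughout. The identity map, seen as a random variable into
    [Omega] with the coarser past sigma-algebra, is independent of [Y], so the pair version applies
    to it. *)
Lemma integral_past d2 (T : measurableType d2) (Y : {RV Pr >-> T})
    (past : set (set Omega)) (h : g_sigma_algebraType past * T -> \bar R) :
  past `<=` measurable ->
  (forall A B, <<s past >> A -> measurable B ->
    Pr (A `&` Y @^-1` B) = Pr A * Pr (Y @^-1` B)) ->
  measurable_fun setT h -> (forall p, 0 <= h p) ->
  \int[Pr]_w h (w, Y w) = \int[Pr]_w \int[distribution Pr Y]_y h (w, y).
Proof.
move=> sub_past indY mh h0.
pose forget (w : Omega) : g_sigma_algebraType past := w.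
have mforget : measurable_fun setT forget.
  move=> _ A mA; rewrite setTI; apply: smallest_sub A mA => //.
  exact: sigma_algebra_measurable.
pose X : {RV Pr >-> g_sigma_algebraType past} :=
  HB.pack forget (isMeasurableFun.Build _ _ _ _ _ mforget).
by apply: (@integral_indep_pair _ _ _ _ X Y h) => // A B mA mB; exact: indY.
Qed.

End conditioning.

(** * Euclidean vectors and measurable matrices *)

Section dot.
Context {R : realType}.
Implicit Types (n : nat) (a : R).

Definition dot n (u v : 'cV[R]_n) : R := \sum_i u i 0 * v i 0.

Lemma dotE n (u v : 'cV[R]_n) : dot u v = (u^T *m v) 0 0.
Proof. by rewrite mxE; apply: eq_bigr => i _; rewrite mxE. Qed.

Lemma dotC n (u v : 'cV[R]_n) : dot u v = dot v u.
Proof. by apply: eq_bigr => i _; rewrite mulrC. Qed.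

Lemma dotDl n (u v w : 'cV[R]_n) : dot (u + v) w = dot u w + dot v w.
Proof. by rewrite -big_split; apply: eq_bigr => i _; rewrite mxE mulrDl. Qed.

Lemma dotZl n a (u v : 'cV[R]_n) : dot (a *: u) v = a * dot u v.
Proof. by rewrite mulr_sumr; apply: eq_bigr => i _; rewrite mxE mulrA. Qed.

Lemma dotDr n (u v w : 'cV[R]_n) : dot w (u + v) = dot w u + dot w v.
Proof. by rewrite dotC dotDl !(dotC w). Qed.

Lemma dotZr n a (u v : 'cV[R]_n) : dot v (a *: u) = a * dot v u.
Proof. by rewrite dotC dotZl dotC. Qed.

Lemma dotNl n (u v : 'cV[R]_n) : dot (- u) v = - dot u v.
Proof. by rewrite -scaleN1r dotZl mulN1r. Qed.

Lemma dotNr n (u v : 'cV[R]_n) : dot v (- u) = - dot v u.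
Proof. by rewrite dotC dotNl dotC. Qed.

Lemma dot_ge0 n (u : 'cV[R]_n) : 0 <= dot u u.
Proof. by apply: sumr_ge0 => i _; rewrite -expr2 sqr_ge0. Qed.

Lemma dot_eq0 n (u : 'cV[R]_n) : dot u u = 0 -> u = 0.
Proof.
move=> /eqP; rewrite psumr_eq0; last by move=> i _; rewrite -expr2 sqr_ge0.
move=> /allP h; apply/colP => i; rewrite mxE.
by have := h i (mem_index_enum i); rewrite /= -expr2 sqrf_eq0 => /eqP.
Qed.

Lemma dot_mulmx m n (A : 'M[R]_(m, n)) u v : dot (A *m u) v = dot u (A^T *m v).
Proof. by rewrite !dotE trmx_mul mulmxA. Qed.

Lemma sqr_dot_le n (u v : 'cV[R]_n) : dot u v ^+ 2 <= dot u u * dot v v.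
Proof.
have [v0|] := eqVneq (dot v v) 0.
  rewrite v0 mulr0 (dot_eq0 v0) /dot big1 ?expr0n// => i _.
  by rewrite mxE mulr0.
move=> v0; have vgt0 : 0 < dot v v by rewrite lt_def v0 dot_ge0.
have := dot_ge0 (dot v v *: u - dot u v *: v).
rewrite !(dotDl, dotDr, dotNl, dotNr, dotZl, dotZr) (dotC v u).
set x := dot u v; set y := dot v v in vgt0 *; set z := dot u u.
by move=> h; rewrite -(ler_pM2l vgt0) -subr_ge0; apply: le_trans h _; lra.
Qed.

Lemma enorm_sqr n (u : 'cV[R]_n) : enorm u ^+ 2 = dot u u.
Proof.
rewrite /enorm sqr_sqrtr; last by apply: sumr_ge0 => i _; rewrite sqr_ge0.
by apply: eq_bigr => i _; rewrite expr2.
Qed.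

Lemma enorm_ge0 n (u : 'cV[R]_n) : 0 <= enorm u.
Proof. exact: sqrtr_ge0. Qed.

Lemma dot_le_enorm n (u v : 'cV[R]_n) : `|dot u v| <= enorm u * enorm v.
Proof.
rewrite -ler_sqr ?nnegrE ?mulr_ge0 ?enorm_ge0// real_normK ?num_real//.
by rewrite exprMn !enorm_sqr sqr_dot_le.
Qed.

Lemma dot_delta n (u : 'cV[R]_n) i : dot u (delta_mx i 0) = u i 0.
Proof.
rewrite /dot (bigD1 i)//= mxE !eqxx mulr1 big1 ?addr0// => j ji.
by rewrite mxE (negPf ji) mulr0.
Qed.

End dot.

Section measurable_matrix.
Context {R : realType} d (S : measurableType d).
Implicit Types (D : set S).

Lemma measurable_mx_entry m n (i : 'I_m) (j : 'I_n) :
  measurable_fun [set: 'M[R]_(m, n)] (fun M => M i j).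
Proof.
move=> _ B mB; rewrite setTI; apply: sub_sigma_algebra.
by exists i, j, B.
Qed.

Lemma measurable_fun_mx m n D (f : S -> 'M[R]_(m, n)) : measurable D ->
  (forall i j, measurable_fun D (fun x => f x i j)) -> measurable_fun D f.
Proof.
move=> mD mf; apply: (@measurability _ _ _ _ _ f (@mx_cylinders _ R m n)) => //.
move=> _ [_ [i [j [B mB ->]]] <-].
exact: mf.
Qed.

Lemma measurable_fun_entry m n D (f : S -> 'M[R]_(m, n)) i j :
  measurable_fun D f -> measurable_fun D (fun x => f x i j).
Proof. by move=> mf; exact: (measurableT_comp (measurable_mx_entry i j) mf). Qed.

Lemma measurable_mulmx m n p D (f : S -> 'M[R]_(m, n)) (g : S -> 'M[R]_(n, p)) :
  measurable D -> measurable_fun D f -> measurable_fun D g ->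
  measurable_fun D (fun x => f x *m g x).
Proof.
move=> mD mf mg; apply: measurable_fun_mx => // i j.
under eq_fun do rewrite mxE.
by apply: measurable_sum => k; apply: measurable_funM; exact: measurable_fun_entry.
Qed.

Lemma measurable_trmx m n D (f : S -> 'M[R]_(m, n)) :
  measurable D -> measurable_fun D f -> measurable_fun D (fun x => (f x)^T).
Proof.
move=> mD mf; apply: measurable_fun_mx => // i j.
by under eq_fun do rewrite mxE; exact: measurable_fun_entry.
Qed.

Lemma measurable_addmx m n D (f g : S -> 'M[R]_(m, n)) :
  measurable D -> measurable_fun D f -> measurable_fun D g ->
  measurable_fun D (fun x => f x + g x).
Proof.
move=> mD mf mg; apply: measurable_fun_mx => // i j.
by under eq_fun do rewrite mxE; apply: measurable_funD; exact: measurable_fun_entry.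
Qed.

Lemma measurable_scalemx m n D a (f : S -> 'M[R]_(m, n)) :
  measurable D -> measurable_fun D f -> measurable_fun D (fun x => a *: f x).
Proof.
move=> mD mf; apply: measurable_fun_mx => // i j.
by under eq_fun do rewrite mxE; apply: measurable_funM => //; exact: measurable_fun_entry.
Qed.

Lemma measurable_submx m n D (f g : S -> 'M[R]_(m, n)) :
  measurable D -> measurable_fun D f -> measurable_fun D g ->
  measurable_fun D (fun x => f x - g x).
Proof.
move=> mD mf mg; apply: measurable_fun_mx => // i j.
by under eq_fun do rewrite !mxE; apply: measurable_funB; exact: measurable_fun_entry.
Qed.

Lemma measurable_dot n D (f g : S -> 'cV[R]_n) :
  measurable_fun D f -> measurable_fun D g -> measurable_fun D (fun x => dot (f x) (g x)).
Proof.
move=> mf mg; apply: measurable_sum => k.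
by apply: measurable_funM; exact: measurable_fun_entry.
Qed.

Lemma measurable_enorm_sqr n D (f : S -> 'cV[R]_n) :
  measurable_fun D f -> measurable_fun D (fun x => enorm (f x) ^+ 2).
Proof. by move=> mf; under eq_fun do rewrite enorm_sqr; exact: measurable_dot. Qed.

End measurable_matrix.

(** * The Beta distribution *)

Section unit_interval_integrals.
Context {R : realType}.
Implicit Types (g G : R -> R) (n : nat).
Local Notation leb := (@lebesgue_measure R).

(* Closed intervals exhausting `]0, 1[, away from the endpoint singularities. *)
Definition inner_itv n : set R := `[n.+3%:R^-1, 1 - n.+3%:R^-1].

(** The shift by 3 keeps the left endpoint strictly below 1/2, so that no [inner_itv n] is empty. *)
Let inv3 n : ((0 : R) < n.+3%:R^-1) && (n.+3%:R^-1 < 2^-1 :> R).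
Proof. by rewrite invr_gt0 ltr0n/= ltf_pV2 ?posrE ?ltr0n// ltr_nat. Qed.

Lemma sub_inner_itv n : inner_itv n `<=` `]0%R, 1%R[.
Proof.
move=> x; rewrite /inner_itv /= !in_itv/= => /andP[x0 x1].
by move: (inv3 n) x0 x1; set e := _^-1 => /andP[? ?] ? ?; apply/andP; split; lra.
Qed.

Lemma bigcup_inner_itv : \bigcup_n inner_itv n = `]0%R, 1%R[%classic.
Proof.
apply/seteqP; split=> [x [n _]|x]; first exact: sub_inner_itv.
rewrite /= in_itv/= => /andP[x0 x1].
pose e := Num.min x (1 - x).
have e0 : 0 < e by rewrite lt_min x0 subr_gt0 x1.
have /andP[ex e1x] : (e <= x) && (e <= 1 - x) by rewrite !ge_min !lexx orbT.
pose n := Num.truncn e^-1.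
have ne : n.+3%:R^-1 <= e.
  rewrite invf_ple ?posrE ?ltr0n//; apply: (le_trans (ltW (truncnS_gt _))).
  by rewrite ler_nat /n ltnS (leq_trans _ (leqnSn _)).
exists n => //; rewrite /inner_itv /= in_itv/=.
by move: ne; set e' := _^-1 => ne; apply/andP; split; lra.
Qed.

Lemma nondecreasing_inner_itv : nondecreasing_seq inner_itv.
Proof.
move=> m n mn; apply/subsetPset => x; rewrite /inner_itv /= !in_itv/= => /andP[x0 x1].
have : n.+3%:R^-1 <= m.+3%:R^-1 :> R by rewrite lef_pV2 ?posrE ?ltr0n// ler_nat.
by set e := n.+3%:R^-1; set e' := m.+3%:R^-1 in x0 x1 *; move=> ?; apply/andP; split; lra.
Qed.

Lemma ge0_cvg_integral_inner_itv g :
  measurable_fun (`]0, 1[ : set R) g -> {in `]0, 1[, forall x, 0 <= g x} ->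
  (\int[leb]_(x in inner_itv n) (g x)%:E @[n --> \oo] -->
   \int[leb]_(x in `]0%R, 1%R[) (g x)%:E)%E.
Proof.
move=> mg g0; rewrite -bigcup_inner_itv.
apply: ge0_nondecreasing_set_cvg_integral.
- exact: nondecreasing_inner_itv.
- by move=> n; exact: measurable_itv.
- move=> n; apply/measurable_EFinP; apply: measurable_funS mg; first exact: measurable_itv.
  exact: sub_inner_itv.
- by move=> n x /sub_inner_itv x01; rewrite lee_fin; apply: g0.
Qed.

Lemma FTC_inner_itv G g n :
  {in `]0, 1[, forall x, is_derive x (1 : R) G (g x)} -> {in `]0, 1[, continuous g} ->
  (\int[leb]_(x in inner_itv n) (g x)%:E =
   (G (1 - n.+3%:R^-1) - G n.+3%:R^-1)%:E)%E.
Proof.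
move=> dG cg; rewrite /inner_itv; move: (inv3 n).
set e := n.+3%:R^-1 => /andP[e0 e2].
have sub x : e <= x -> x <= 1 - e -> x \in `]0, 1[.
  by move=> ? ?; rewrite in_itv/=; apply/andP; split; lra.
have cG x : x \in `]0, 1[ -> {for x, continuous G}.
  move=> x01; have [dGx _] := dG x x01.
  by apply: differentiable_continuous; apply/derivable1_diffP.
rewrite EFinB; apply: continuous_FTC2; first by lra.
- apply: continuous_in_subspaceT => x; rewrite inE/= in_itv/= => /andP[? ?].
  by apply: cg; exact: sub.
- split.
  + move=> x; rewrite in_itv/= => /andP[h1 h2].
    by have [] := dG x (sub _ (ltW h1) (ltW h2)).
  + by apply: cvg_at_right_filter; apply: cG; apply: sub; lra.
  + by apply: cvg_at_left_filter; apply: cG; apply: sub; lra.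
- move=> x; rewrite in_itv/= => /andP[h1 h2]; rewrite derive1E.
  by have [_ ->] := dG x (sub _ (ltW h1) (ltW h2)).
Qed.

End unit_interval_integrals.

Section beta_kernel.
Context {R : realType}.
Implicit Types (a b t : R).
Local Notation leb := (@lebesgue_measure R).
Local Notation K := (@beta_kernel R).

Lemma beta_kernel_gt0 a b t : t \in `]0, 1[ -> 0 < K a b t.
Proof.
by rewrite in_itv/= => /andP[? ?]; rewrite /beta_kernel mulr_gt0// powR_gt0// subr_gt0.
Qed.

Let is_derive_powR_onem b t : t < 1 ->
  is_derive t (1 : R) (fun t => (1 - t) `^ b) (- (b * (1 - t) `^ (b - 1))).
Proof.
move=> t1.
have h1 : is_derive t (1 : R) (fun t : R => 1 - t) (- 1).
  by apply: is_derive_eq; rewrite add0r mul1r.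
have h2 : is_derive (1 - t) (1 : R) (@powR R ^~ b) (b * (1 - t) `^ (b - 1)).
  by apply: is_derive1_powR; rewrite subr_gt0.
by have := is_derive1_comp (f := @powR R ^~ b) (g := fun t => 1 - t) (x := t);
  move=> /(_ _ _ h2 h1); rewrite mulrN1.
Qed.

Let continuous_powR_oo01 a t : t \in `]0, 1[ -> {for t, continuous (@powR R ^~ a)}.
Proof.
rewrite in_itv/= => /andP[t0 _]; have [h _] := is_derive1_powR a t0.
by apply: differentiable_continuous; apply/derivable1_diffP.
Qed.

Let continuous_powR_onem a t : t \in `]0, 1[ ->
  {for t, continuous (fun t => (1 - t) `^ a)}.
Proof.
rewrite in_itv/= => /andP[_ t1]; have [h _] := is_derive_powR_onem a t1.
by apply: differentiable_continuous; apply/derivable1_diffP.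
Qed.

Lemma continuous_beta_kernel a b : {in `]0, 1[, continuous (K a b)}.
Proof.
move=> t t01; apply: cvgM; [exact: continuous_powR_oo01|exact: continuous_powR_onem].
Qed.

Lemma measurable_beta_kernel a b (A : set R) : measurable A -> measurable_fun A (K a b).
Proof.
move=> mA; apply: measurable_funTS; apply: measurable_funM => //.
apply: (measurableT_comp (@measurable_powR R _)); exact: measurable_funB.
Qed.

Let inv3_oo01 n : ((n.+3%:R^-1 : R) \in `]0, 1[) && ((1 - n.+3%:R^-1 : R) \in `]0, 1[).
Proof.
have h : (n.+3%:R^-1 : R) \in `]0, 1[.
  by rewrite in_itv/= invr_gt0 ltr0n invf_lt1 ?ltr0n// ltr1n.
move: h; set e := n.+3%:R^-1; rewrite !in_itv/= => /andP[? ?].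
by apply/andP; split; apply/andP; split; lra.
Qed.

(* 1 / (t (1 - t)) = 1 / t + 1 / (1 - t), and the square root is subadditive. *)
Let beta_kernel_half_le t : t \in `]0, 1[ ->
  K 2^-1 2^-1 t <= t `^ (2^-1 - 1) + (1 - t) `^ (2^-1 - 1).
Proof.
rewrite in_itv/= => /andP[t0 t1]; rewrite /beta_kernel.
have t1' : 0 < 1 - t by rewrite subr_gt0.
have sqrE x : 0 < x -> (x `^ (2^-1 - 1 : R)) ^+ 2 = x^-1.
  move=> x0; rewrite expr2 -powRD; last by rewrite (gt_eqF x0) implybT.
  have -> : 2^-1 - 1 + (2^-1 - 1) = - 1 :> R by lra.
  by rewrite powR_inv1// ltW.
have := sqrE _ t0; have := sqrE _ t1'.
set u := t `^ _; set v := (1 - t) `^ _ => v2 u2.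
have u0 : 0 <= u by exact: powR_ge0.
have v0 : 0 <= v by exact: powR_ge0.
rewrite -(ler_pXn2r (n := 2))// ?nnegrE ?addr_ge0 ?mulr_ge0//.
rewrite exprMn sqrrD u2 v2.
have -> : t^-1 / (1 - t) = t^-1 + (1 - t)^-1.
  by field; rewrite !gt_eqF.
by rewrite -addrA [_ *+ 2 + _]addrC addrA lerDl mulrn_wge0// mulr_ge0.
Qed.

(** The range of parameters covers [r / 2] and [(d - r) / 2] for [1 <= r < d]. Powers on []0, 1[]
    decrease with the exponent, which reduces to both parameters being 1/2; the dominating [g] has
    the bounded primitive [G]. *)
Lemma integrable_beta_kernel a b : 2^-1 <= a -> 2^-1 <= b ->
  leb.-integrable `]0, 1[ (EFin \o K a b).
Proof.
move=> a2 b2.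
pose g t : R := t `^ (2^-1 - 1) + (1 - t) `^ (2^-1 - 1).
pose G t : R := 2 * t `^ 2^-1 - 2 * (1 - t) `^ 2^-1.
have mg : measurable_fun (`]0, 1[ : set R) g.
  apply: measurable_funTS; apply: measurable_funD => //.
  apply: (measurableT_comp (@measurable_powR R _)); exact: measurable_funB.
have g0 t : 0 <= g t by rewrite addr_ge0// powR_ge0.
have dG : {in `]0, 1[, forall t, is_derive t (1 : R) G (g t)}.
  move=> t; rewrite in_itv/= => /andP[t0 t1].
  have h1 := is_derive1_powR 2^-1 t0; have h2 := is_derive_powR_onem 2^-1 t1.
  apply: is_derive_eq; rewrite /g /GRing.scale/=.
  by rewrite mulrN opprK !mulrA divff ?mul1r.
have cg : {in `]0, 1[, continuous g}.
  by move=> t t01; apply: cvgD; [exact: continuous_powR_oo01|exact: continuous_powR_onem].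
have Gle : forall t, t \in `]0, 1[ -> `|G t| <= 2.
  move=> t; rewrite in_itv/= /G => /andP[t0 t1].
  have le1 x : 0 < x -> x <= 1 -> 0 <= x `^ (2^-1 : R) <= 1.
    by move=> x0 x1; rewrite powR_ge0/= -[leRHS](powRr0 x) ger_powR// x0.
  have /andP[? ?] := le1 _ t0 (ltW t1).
  have /andP[? ?] : 0 <= (1 - t) `^ (2^-1 : R) <= 1 by apply: le1; lra.
  by rewrite ler_norml; apply/andP; split; lra.
have gfin : (\int[leb]_(x in `]0%R, 1%R[) (g x)%:E <= 4%:E)%E.
  have cv := ge0_cvg_integral_inner_itv mg (fun t _ => g0 t).
  rewrite -(cvg_lim _ cv)//; apply: lime_le; first by apply/cvg_ex; eexists; exact: cv.
  apply: nearW => n; rewrite (FTC_inner_itv _ dG cg) lee_fin.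
  have /andP[h1 h2] := inv3_oo01 n; have := Gle _ h1; have := Gle _ h2.
  rewrite !ler_norml => /andP[? ?] /andP[? ?]; lra.
apply: (@le_integrable _ _ _ leb _ _ _ (EFin \o g)).
- exact: measurable_itv.
- by apply/measurable_EFinP; apply: measurable_beta_kernel; exact: measurable_itv.
- move=> t /= t01; rewrite lee_fin [leRHS]ger0_norm// ger0_norm; last first.
    exact/ltW/beta_kernel_gt0.
  apply: le_trans (beta_kernel_half_le t01).
  move: t01; rewrite in_itv/= => /andP[t0 t1].
  by rewrite /beta_kernel ler_pM ?powR_ge0// ger_powR; lra.
- apply/integrableP; split; first exact/measurable_EFinP.
  apply: le_lt_trans (ltry 4).
  under eq_integral do rewrite /= ger0_norm//.
  exact: gfin.
Qed.

Local Notation B a b := (\int[leb]_(t in `]0%R, 1%R[) K a b t).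

Lemma beta_integral_gt0 a b : 2^-1 <= a -> 2^-1 <= b -> 0 < B a b.
Proof.
move=> a2 b2; have iK := integrable_beta_kernel a2 b2.
(* [inner_itv 0] is [[1/3, 2/3]], where [t^(a - 1) >= t^a >= 3^-a], and likewise for [1 - t]. *)
pose c : R := 3^-1 `^ a * 3^-1 `^ b.
have c0 : 0 < c by rewrite mulr_gt0// powR_gt0.
have iKn : leb.-integrable (inner_itv 0) (EFin \o K a b).
  by apply: integrableS iK => //; [exact: measurable_itv..|exact: sub_inner_itv].
have h : (\int[leb]_(t in inner_itv 0) c%:E <= \int[leb]_(t in `]0%R, 1%R[) (K a b t)%:E)%E.
  apply: (@le_trans _ _ (\int[leb]_(t in inner_itv 0) (K a b t)%:E)%E).
    apply: ge0_le_integral => //; first exact: measurable_itv.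
    - by move=> t _; rewrite lee_fin ltW.
    - by apply/measurable_EFinP; apply: measurable_beta_kernel; exact: measurable_itv.
    move=> t; rewrite /inner_itv/= in_itv/= => /andP[t0 t1]; rewrite lee_fin.
    rewrite /beta_kernel ler_pM ?powR_ge0//.
      apply: (@le_trans _ _ (t `^ a)); last by apply: ger_powR; lra.
      by apply: ge0_ler_powR; rewrite ?nnegrE; lra.
    apply: (@le_trans _ _ ((1 - t) `^ b)); last by apply: ger_powR; lra.
    by apply: ge0_ler_powR; rewrite ?nnegrE; lra.
  apply: ge0_subset_integral => //; [exact: measurable_itv..| | |exact: sub_inner_itv].
  - by apply/measurable_EFinP; apply: measurable_beta_kernel; exact: measurable_itv.
  - by move=> t t01; rewrite lee_fin ltW// beta_kernel_gt0.
rewrite /Rintegral -lte_fin fineK; last exact: integrable_fin_num.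
apply: lt_le_trans h.
rewrite integral_cst; last exact: measurable_itv.
rewrite [X in (_ * X)%E](_ : _ = (1 - 3^-1 - 3^-1)%:E); last first.
  by apply: etrans (lebesgue_measure_itv _) _; rewrite /= lte_fin ifT ?EFinB//; lra.
by rewrite -EFinM lte_fin mulr_gt0//; lra.
Qed.

Lemma cvg_beta_integral a b : 2^-1 <= a -> 2^-1 <= b ->
  \int[leb]_(t in inner_itv n) K a b t @[n --> \oo] --> B a b.
Proof.
move=> a2 b2; apply: fine_cvg; rewrite fineK; last first.
  exact/integrable_fin_num/integrable_beta_kernel.
apply: ge0_cvg_integral_inner_itv; first exact: measurable_beta_kernel.
by move=> t t01; exact/ltW/beta_kernel_gt0.
Qed.

Lemma beta_integral_split a b : 2^-1 <= a -> 2^-1 <= b ->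
  B a b = B (a + 1) b + B a (b + 1).
Proof.
move=> a2 b2; rewrite -RintegralD//; last 2 first.
- by apply: integrable_beta_kernel => //; lra.
- by apply: integrable_beta_kernel => //; lra.
apply: eq_Rintegral => t; rewrite inE/= in_itv/= => /andP[t0 t1].
rewrite /beta_kernel !addrK.
rewrite -[in X in X * _ + _](mulr_powRB1 (ltW t0)); last lra.
rewrite -[in X in _ + _ * X](@mulr_powRB1 _ (1 - t)); lra.
Qed.

(** Integration of the derivative of [t^a (1 - t)^b], which vanishes at both ends. It is carried out
    on the inner intervals and passed to the limit, because the kernels may be singular at 0 and
    1. *)
Lemma beta_integral_parts a b : 2^-1 <= a -> 2^-1 <= b ->
  a * B a (b + 1) = b * B (a + 1) b.
Proof.
move=> a2 b2.
pose G t : R := t `^ a * (1 - t) `^ b.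
pose g t : R := a * K a (b + 1) t - b * K (a + 1) b t.
have dG : {in `]0, 1[, forall t, is_derive t (1 : R) G (g t)}.
  move=> t; rewrite in_itv/= => /andP[t0 t1].
  have h1 := is_derive1_powR a t0; have h2 := is_derive_powR_onem b t1.
  apply: is_derive_eq; rewrite /g /beta_kernel !addrK /GRing.scale/=.
  ring.
have cg : {in `]0, 1[, continuous g}.
  move=> t t01; apply: cvgB; apply: cvgMr; exact: continuous_beta_kernel.
have le1 (x c : R) : 0 <= c -> 0 < x < 1 -> x `^ c <= 1.
  by move=> c0 /andP[x0 x1]; rewrite -[leRHS](powRr0 x) ger_powR// x0 ltW.
have e01 n : ((0 : R) < n.+3%:R^-1) && (n.+3%:R^-1 < (1 : R)).
  by have /andP[] := inv3_oo01 n; rewrite in_itv.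
have e0 (c : R) : 0 < c -> (n.+3%:R^-1 : R) `^ c @[n --> \oo] --> (0 : R).
  move=> c0; have /cvg_at_rightP := powR_cvg0 c0.
  move=> /(_ (fun n => n.+3%:R^-1)); apply; split=> [n|]; first by rewrite invr_gt0 ltr0n.
  have := @cvg_harmonic R; rewrite -(cvg_shiftn 2); apply: cvg_trans.
  by apply: near_eq_cvg; apply: nearW => m; rewrite /harmonic /= addn2.
have G0 : G (1 - n.+3%:R^-1) - G n.+3%:R^-1 @[n --> \oo] --> (0 : R).
  rewrite -(subr0 0); apply: cvgB.
    apply: (@squeeze_cvgr _ _ _ _ (cst 0) (fun n => n.+3%:R^-1 `^ b)); last 2 first.
    - exact: cvg_cst.
    - by apply: e0; lra.
    apply: nearW => n; rewrite /G subKr mulr_ge0 ?powR_ge0//=.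
    rewrite ler_piMl ?powR_ge0// le1//; first lra.
    by move: (e01 n); set e := _^-1 => /andP[? ?]; apply/andP; split; lra.
  apply: (@squeeze_cvgr _ _ _ _ (cst 0) (fun n => n.+3%:R^-1 `^ a)); last 2 first.
  - exact: cvg_cst.
  - by apply: e0; lra.
  apply: nearW => n; rewrite /G mulr_ge0 ?powR_ge0//=.
  rewrite ler_piMr ?powR_ge0// le1//; first lra.
  by move: (e01 n); set e := _^-1 => /andP[? ?]; apply/andP; split; lra.
have Ge n : a * \int[leb]_(t in inner_itv n) K a (b + 1) t -
    b * \int[leb]_(t in inner_itv n) K (a + 1) b t = G (1 - n.+3%:R^-1) - G n.+3%:R^-1.
  have iK c c' : 2^-1 <= c -> 2^-1 <= c' -> leb.-integrable (inner_itv n) (EFin \o K c c').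
    move=> c2 c'2; apply: integrableS (integrable_beta_kernel c2 c'2) => //.
      exact: measurable_itv.
    exact: sub_inner_itv.
  have mn : measurable (inner_itv n : set (measurableTypeR R)) by exact: measurable_itv.
  rewrite -!RintegralZl//; [|apply: iK; lra..].
  rewrite -RintegralB//; last 2 first.
    by apply: (@integrableZl _ _ _ leb _ _ a (EFin \o K a (b + 1))) => //; apply: iK; lra.
    by apply: (@integrableZl _ _ _ leb _ _ b (EFin \o K (a + 1) b)) => //; apply: iK; lra.
  by rewrite /Rintegral (FTC_inner_itv n dG cg).
apply/eqP; rewrite -subr_eq0; apply/eqP.
pose u n := a * \int[leb]_(t in inner_itv n) K a (b + 1) t -
    b * \int[leb]_(t in inner_itv n) K (a + 1) b t.
have u0 : u n @[n --> \oo] --> (0 : R).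
  by apply: cvg_trans G0; apply: near_eq_cvg; apply: nearW => n; rewrite /u Ge.
have a1 : 2^-1 <= a + 1 by lra.
have b1 : 2^-1 <= b + 1 by lra.
have u1 : u n @[n --> \oo] --> a * B a (b + 1) - b * B (a + 1) b.
  by apply: cvgB; apply: cvgMr; [exact: cvg_beta_integral a2 b1|exact: cvg_beta_integral a1 b2].
by transitivity (limn u); [apply/esym|]; exact: cvg_lim.
Qed.

(** The recursion usually read off the Gamma function; here it solves the two linear relations given
    by the splitting [1 = t + (1 - t)] and by parts. *)
Lemma beta_integralSl a b : 2^-1 <= a -> 2^-1 <= b ->
  B (a + 1) b = a / (a + b) * B a b.
Proof.
move=> a2 b2; have := beta_integral_parts a2 b2; have := beta_integral_split a2 b2.
move: (B a b) (B (a + 1) b) (B a (b + 1)) => x y z -> e.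
apply: (@mulfI _ (a + b)); first by rewrite gt_eqF//; lra.
rewrite mulrA mulrCA divff ?mulr1; last by rewrite gt_eqF//; lra.
by rewrite mulrDl -e; ring.
Qed.

End beta_kernel.

(** The weight [W] lets one statement serve both the Haar measure, with [W] equal to 1, and Lebesgue
    measure with the Beta kernel. *)
Lemma Rintegral_horner d (T : measurableType d) (R : realType)
    (m : {measure set T -> \bar R}) (D : set T) (Y W : T -> R) (p : {poly R}) :
  measurable D ->
  (forall i, m.-integrable D (EFin \o (fun x => Y x ^+ i * W x))) ->
  m.-integrable D (EFin \o (fun x => p.[Y x] * W x)) /\
  \int[m]_(x in D) (p.[Y x] * W x) =
    \sum_(i < size p) p`_i * \int[m]_(x in D) (Y x ^+ i * W x).
Proof.
move=> mD iYW.
have -> : (fun x => p.[Y x] * W x) =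
    (fun x => \sum_(i < size p) p`_i * (Y x ^+ i * W x)).
  by apply/funext => x; rewrite horner_coef mulr_suml; apply: eq_bigr => i _; rewrite mulrA.
elim: (size p) => [|n [IHi IH]].
  rewrite big_ord0; split.
    by apply: eq_integrable (integrable0 _ _) => // x _; rewrite /= big_ord0.
  by under eq_Rintegral do rewrite big_ord0; rewrite Rintegral_cst// mul0r.
have iZ : m.-integrable D (EFin \o (fun x => p`_n * (Y x ^+ n * W x))).
  by apply: (@integrableZl _ _ _ m D mD p`_n (EFin \o (fun x => Y x ^+ n * W x))).
split.
  apply: eq_integrable (integrableD mD IHi iZ) => // x _.
  by rewrite /= big_ord_recr/= EFinD.
under eq_Rintegral do rewrite big_ord_recr/=.
by rewrite RintegralD// IH RintegralZl// big_ord_recr.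
Qed.

(** * Polynomials approximating a step function *)

Section step_polynomials.
Context {R : realType}.
Implicit Types (t x y : R) (n N : nat).

Lemma bernoulli_le1Xn y N : 0 <= y <= 1 -> 1 - N%:R * y <= (1 - y) ^+ N.
Proof.
move=> /andP[y0 y1]; elim: N => [|N IH]; first by rewrite mul0r subr0 expr0.
apply: (@le_trans _ _ ((1 - N%:R * y) * (1 - y))); last first.
  by rewrite exprSr ler_wpM2r// subr_ge0.
have : 0 <= N%:R * y ^+ 2 by rewrite mulr_ge0// sqr_ge0.
by rewrite -natr1; nra.
Qed.

(** Induction on [(1 - y) (1 + (N + 1) y) <= 1 + N y]; the upper counterpart of Bernoulli's
    inequality. *)
Lemma bernoulli_ge1Xn y N : 0 <= y <= 1 -> (1 - y) ^+ N * (1 + N%:R * y) <= 1.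
Proof.
move=> /andP[y0 y1]; elim: N => [|N IH]; first by rewrite expr0 mul0r addr0 mul1r.
apply: le_trans IH; rewrite exprSr -mulrA ler_wpM2l ?exprn_ge0 ?subr_ge0//.
have : 0 <= N%:R * y ^+ 2 by rewrite mulr_ge0// sqr_ge0.
by have := sqr_ge0 y; rewrite -natr1; nra.
Qed.

(* On `[0, 1]` these polynomials converge to 1 below [t] and to 0 above [t]. *)
Definition step_poly t n : {poly R} := (1 - 'X^n) ^+ (Num.truncn (t^-1 ^+ n)).

Lemma horner_step_poly t n x :
  (step_poly t n).[x] = (1 - x ^+ n) ^+ (Num.truncn (t^-1 ^+ n)).
Proof. by rewrite /step_poly !hornerE. Qed.

Lemma step_poly_ge0 t n x : 0 <= x <= 1 -> 0 <= (step_poly t n).[x] <= 1.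
Proof.
move=> /andP[x0 x1]; rewrite horner_step_poly.
have h : 0 <= x ^+ n <= 1 by rewrite exprn_ge0//= exprn_ile1.
by move: h => /andP[? ?]; rewrite exprn_ge0 ?exprn_ile1; lra.
Qed.

Lemma step_poly_lower t n x : 0 < t -> 0 <= x <= 1 ->
  1 - (x / t) ^+ n <= (step_poly t n).[x].
Proof.
move=> t0 /andP[x0 x1]; rewrite horner_step_poly.
have h : 0 <= x ^+ n <= 1 by rewrite exprn_ge0//= exprn_ile1.
apply: le_trans (bernoulli_le1Xn _ h).
rewrite lerD2l lerN2 exprMn mulrC ler_wpM2l ?exprn_ge0//.
by rewrite truncn_le// exprn_ge0// invr_ge0 ltW.
Qed.

(** The exponent [N] satisfies [N + 1 >= t^-n]; since [x^n <= 1], this gives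
    [1 + N x^n >= (x / t)^n], to be inserted in [bernoulli_ge1Xn]. *)
Lemma step_poly_upper t n x : 0 < t -> 0 < x <= 1 -> (step_poly t n).[x] <= (t / x) ^+ n.
Proof.
move=> t0 /andP[x0 x1]; rewrite horner_step_poly.
have h : 0 <= x ^+ n <= 1 by rewrite exprn_ge0 ?exprn_ile1// ltW.
have := bernoulli_ge1Xn (Num.truncn (t^-1 ^+ n)) h.
have xt0 : 0 < (x / t) ^+ n by rewrite exprn_gt0// divr_gt0.
have -> : (t / x) ^+ n = ((x / t) ^+ n)^-1 by rewrite -exprVn invf_div.
set N := Num.truncn _ => le1.
rewrite -[leRHS]mul1r ler_pdivlMr//; apply: le_trans le1.
rewrite ler_wpM2l//.
  by rewrite exprn_ge0// subr_ge0; case/andP: h.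
have : t^-1 ^+ n <= N%:R + 1.
  by rewrite natr1 ltW// truncnS_gt.
move: h => /andP[]; rewrite exprMn; set u := x ^+ n; set v := t^-1 ^+ n => u0 u1 ?.
by have : u * v <= u * (N%:R + 1); [rewrite ler_wpM2l|lra].
Qed.

End step_polynomials.

(** * From equal moments to a comparison of distribution functions *)

Section beta_moments.
Context {R : realType}.
Local Notation leb := (@lebesgue_measure R).
Local Notation K := (@beta_kernel R).
Variables (a b : R).
Hypotheses (a2 : 2^-1 <= a) (b2 : 2^-1 <= b).

Definition beta_moment i : R :=
  (\int[leb]_(t in `]0%R, 1%R[) (t ^+ i * K a b t)) / \int[leb]_(t in `]0%R, 1%R[) K a b t.

Let exprM_beta_kernel i t : t \in `]0, 1[ -> t ^+ i * K a b t = K (a + i%:R) b t.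
Proof.
rewrite in_itv/= => /andP[t0 t1]; rewrite /beta_kernel mulrA; congr (_ * _).
by rewrite -powR_mulrn ?ltW// -powRD ?(gt_eqF t0) ?implybT//; congr (_ `^ _); ring.
Qed.

Lemma integrable_exprM_beta_kernel i :
  leb.-integrable `]0, 1[ (EFin \o (fun t => t ^+ i * K a b t)).
Proof.
have a2' : 2^-1 <= a + i%:R by rewrite (le_trans a2)// lerDl.
apply: eq_integrable (integrable_beta_kernel a2' b2); first exact: measurable_itv.
by move=> t; rewrite inE/= => t01; rewrite /= exprM_beta_kernel.
Qed.

Let beta_moment_shift i :
  \int[leb]_(t in `]0%R, 1%R[) (t ^+ i * K a b t) =
  \int[leb]_(t in `]0%R, 1%R[) K (a + i%:R) b t.
Proof. by apply: eq_Rintegral => t; rewrite inE/= => /exprM_beta_kernel. Qed.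

Lemma beta_moment0 : beta_moment 0 = 1.
Proof.
by rewrite /beta_moment beta_moment_shift addr0 divff// gt_eqF// beta_integral_gt0.
Qed.

Lemma beta_momentS i : (a + b + i%:R) * beta_moment i.+1 = (a + i%:R) * beta_moment i.
Proof.
have a2' : 2^-1 <= a + i%:R by rewrite (le_trans a2)// lerDl.
rewrite /beta_moment !beta_moment_shift -natr1 addrA beta_integralSl//.
have -> : a + i%:R + b = a + b + i%:R by ring.
have i0 : 0 <= i%:R :> R by [].
field; rewrite gt_eqF ?beta_integral_gt0//= gt_eqF//.
have h0 : (0 : R) < 2^-1 by rewrite invr_gt0.
by rewrite ltr_wpDr// addr_gt0// (lt_le_trans h0).
Qed.

(** The integral of the step polynomials over [Y < t] tends to the measure on the left, and it is at
    most their full integral, a Beta integral. The strict inequality on the left and the closed end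
    of []0, t]] on the right keep the value of the polynomials at [t] itself out of the argument. *)
Lemma le_reg_incomplete_beta_of_moments d (T : measurableType d)
    (nu : probability T R) (D : set T) (Y : T -> R) (t : R) :
  0 < t < 1 -> measurable D -> measurable_fun D Y ->
  (forall x, D x -> 0 <= Y x <= 1) ->
  (forall i, \int[nu]_(x in D) (Y x ^+ i) = beta_moment i) ->
  (nu (D `&` [set x | (Y x < t)%R]) <= (reg_incomplete_beta t a b)%:E)%E.
Proof.
move=> /andP[t0 t1] mD mY Y01 momY.
have B0 := beta_integral_gt0 a2 b2.
have iK := integrable_beta_kernel a2 b2.
pose B := \int[leb]_(t in `]0%R, 1%R[) K a b t.
pose p := step_poly t.
have mpY n : measurable_fun D (fun x => (p n).[Y x]).
  rewrite /p; under eq_fun do rewrite horner_step_poly.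
  by apply: measurable_funX; apply: measurable_funB => //; exact: measurable_funX.
have pY01 n x : D x -> 0 <= (p n).[Y x] <= 1 by move=> /Y01; exact: step_poly_ge0.
have nuD : (nu D < +oo)%E by rewrite -ge0_fin_numE// fin_num_measure.
have ipY n : nu.-integrable D (EFin \o (fun x => (p n).[Y x])).
  apply: measurable_bounded_integrable => //; exists 1; split => // M M1 x Dx /=.
  by have /andP[p0 p1] := pY01 n x Dx; rewrite ger0_norm// (le_trans p1)// ltW.
(* Here the moments enter: a polynomial has the same mean under [Y] and under the Beta law. *)
have EpY n : \int[nu]_(x in D) (p n).[Y x] =
    (\int[leb]_(s in `]0%R, 1%R[) ((p n).[s] * K a b s)) / B.
  rewrite (@Rintegral_horner _ _ R leb `]0, 1[ id (K a b) (p n) _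
    integrable_exprM_beta_kernel).2; last first.
    exact: measurable_itv.
  have iY i : nu.-integrable D (EFin \o (fun x => Y x ^+ i * cst 1 x)).
    apply: measurable_bounded_integrable => //.
      by apply: measurable_funM => //; exact: measurable_funX.
    exists 1; split => // M M1 x Dx /=; rewrite mulr1.
    have /andP[y0 y1] := Y01 x Dx.
    by rewrite ger0_norm ?exprn_ge0// (le_trans (exprn_ile1 _ _ _))// ltW.
  have [_] := Rintegral_horner (p n) mD iY.
  under eq_Rintegral do rewrite /= mulr1.
  move=> ->; rewrite mulr_suml; apply: eq_bigr => i _; rewrite -mulrA; congr (_ * _).
  under eq_Rintegral do rewrite /= mulr1.
  exact: momY.
have ipK n : leb.-integrable `]0, 1[ (EFin \o (fun s => (p n).[s] * K a b s)).
  apply: (@Rintegral_horner _ _ R leb `]0, 1[ id (K a b) (p n) _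
    integrable_exprM_beta_kernel).1; exact: measurable_itv.
have sub0t : `]0, t] `<=` (`]0, 1[ : set R).
  by apply: subset_itvl; rewrite bnd_simp.
have subt1 : `]t, 1[ `<=` (`]0, 1[ : set R).
  by apply: subset_itvr; rewrite bnd_simp ltW.
have pK01 n s : s \in `]0, 1[ -> 0 <= (p n).[s] * K a b s <= K a b s.
  move=> s01; have K0 := beta_kernel_gt0 a b s01.
  move: s01; rewrite in_itv/= => /andP[s0 s1].
  have /andP[p0 p1] : 0 <= (p n).[s] <= 1 by apply: step_poly_ge0; rewrite !ltW.
  by rewrite mulr_ge0 ?(ltW K0)//= ler_piMl// ltW.
(* Bounding the polynomial by 1 on []0, t]] leaves only the part above [t], which dominated
   convergence sends to 0 in [cvK]. *)
have pK n : \int[leb]_(s in `]0%R, 1%R[) ((p n).[s] * K a b s) <=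
   \int[leb]_(s in `]0%R, t]) K a b s + \int[leb]_(s in `]t, 1%R[) ((p n).[s] * K a b s).
  have U : `]0%R, 1%R[%classic = `]0, t] `|` `]t, 1[ :> set R.
    by rewrite -itv_bndbnd_setU// bnd_simp// ltW.
  rewrite [in leLHS]U Rintegral_setU; last 4 first.
  - exact: measurable_itv.
  - exact: measurable_itv.
  - by rewrite -U; exact: ipK.
  - apply/eqP; rewrite -subset0 => s /=; rewrite !in_itv/= => -[/andP[_ st] /andP[ts _]].
    by move: (lt_le_trans ts st); rewrite ltxx.
  rewrite lerD2r; apply: le_Rintegral.
  - exact: measurable_itv.
  - by apply: integrableS (ipK n) => //; exact: measurable_itv.
  - by apply: integrableS iK => //; exact: measurable_itv.
  - by move=> s /sub0t s01; have /andP[] := pK01 n s s01.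
have cvK : \int[leb]_(s in `]t, 1%R[) ((p n).[s] * K a b s) @[n --> \oo] --> (0 : R).
  apply: fine_cvg.
  have [|||||_ _] := @dominated_convergence _ _ R leb `]t, 1[ (measurable_itv _)
    (fun n s => ((p n).[s] * K a b s)%:E) (fun=> 0%E) (EFin \o K a b).
  - move=> n; apply/measurable_EFinP; apply: measurable_funM; last first.
      by apply: measurable_beta_kernel; exact: measurable_itv.
    rewrite (_ : horner (p n) =
      (fun s => (1 - s ^+ n) ^+ (Num.truncn (t^-1 ^+ n)))); last first.
      by apply/funext => s; rewrite horner_step_poly.
    by apply: measurable_funX; exact: measurable_funB.
  - exact: measurable_cst.
  - apply: aeW => s /= ts1; apply: cvg_EFin; first exact: nearW.
    move: (subt1 _ ts1); rewrite /= => s01.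
    move: ts1; rewrite in_itv/= => /andP[ts s1].
    apply: (@squeeze_cvgr _ _ _ _ (cst 0) (fun n => (t / s) ^+ n * K a b s)).
    + apply: nearW => n; have /andP[-> _] /= := pK01 n s s01.
      apply: ler_wpM2r; first exact/ltW/beta_kernel_gt0.
      by apply: step_poly_upper => //; rewrite (lt_trans t0 ts) ltW.
    + exact: cvg_cst.
    + rewrite -(mul0r (K a b s)); apply: cvgMl; apply: cvg_expr.
      by rewrite ger0_norm ?ltr_pdivrMr ?mul1r ?(lt_trans t0)// divr_ge0// ltW// (lt_trans t0).
  - by apply: integrableS iK => //; exact: measurable_itv.
  - apply: aeW => s n /subt1 /= s01; rewrite lee_fin.
    by have /andP[k0 k1] := pK01 n s s01; rewrite ger0_norm.
  by rewrite integral0.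
pose E := D `&` [set x | Y x < t].
have mE : measurable E.
  by rewrite /E -preimage_itvNyo; apply: mY => //; exact: measurable_itv.
have subE : E `<=` D by move=> x [].
have cvY : \int[nu]_(x in E) (p n).[Y x] @[n --> \oo] --> fine (nu E).
  apply: fine_cvg; rewrite fineK ?fin_num_measure//.
  have [|||||_ _] := @dominated_convergence _ _ R nu E mE
    (fun n x => ((p n).[Y x])%:E) (cst 1%E) (cst 1%E).
  - by move=> n; apply: measurable_int (integrableS _ _ subE (ipY n)).
  - exact: measurable_cst.
  - apply: aeW => x [Dx /= xt]; apply: cvg_EFin; first exact: nearW.
    have Yx := Y01 x Dx; have /andP[y0 y1] := Yx.
    apply: (@squeeze_cvgr _ _ _ _ (fun n => 1 - (Y x / t) ^+ n) (cst 1)).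
    + apply: nearW => n; rewrite step_poly_lower//=.
      by have /andP[] := pY01 n x Dx.
    + rewrite -[X in _ --> X]subr0; apply: cvgB; first exact: cvg_cst.
      apply: cvg_expr.
      by rewrite ger0_norm ?ltr_pdivrMr ?mul1r// divr_ge0// ltW.
    + exact: cvg_cst.
  - by apply: integrableS (finite_measure_integrable_cst nu 1 measurableT).
  - apply: aeW => x n [Dx _]; rewrite lee_fin.
    by have /andP[k0 k1] := pY01 n x Dx; rewrite ger0_norm.
  by rewrite integral_cst// mul1e.
rewrite -(fineK (fin_num_measure nu _ mE)) lee_fin.
rewrite /reg_incomplete_beta /beta_law.
have -> : `]-oo, t]%classic `&` `]0%R, 1%R[%classic = `]0%R, t]%classic :> set R.
  apply/seteqP; split=> s /=; rewrite !in_itv/=; first by move=> [-> /andP[->]].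
  by move=> /andP[-> st]; rewrite st (le_lt_trans st).
rewrite -[X in _ <= X / _]addr0.
have lim : (\int[leb]_(s in `]0%R, t]) K a b s +
    \int[leb]_(s in `]t, 1%R[) ((p n).[s] * K a b s)) / B @[n --> \oo] -->
    (\int[leb]_(s in `]0%R, t]) K a b s + 0) / B.
  by apply: cvgMl; apply: cvgD; [exact: cvg_cst|exact: cvK].
apply: (ler_cvg_to cvY lim).
apply: nearW => n.
apply: (@le_trans _ _ (\int[nu]_(x in D) (p n).[Y x])).
  rewrite /Rintegral fine_le//.
  - by apply: integrable_fin_num => //; apply: integrableS (ipY n).
  - by apply: integrable_fin_num => //; exact: ipY.
  apply: ge0_subset_integral => //; first exact: measurable_int (ipY n).
  by move=> x Dx; rewrite lee_fin; have /andP[] := pY01 n x Dx.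
by rewrite EpY ler_pM2r ?invr_gt0.
Qed.

End beta_moments.

(** * Projection on a Haar-distributed subspace *)

Section orthogonal.
Context {R : realType}.
Implicit Types (n : nat).

Lemma orthogonal_mulmxT n (U : 'M[R]_n) : orthogonal_group U -> U *m U^T = 1%:M.
Proof. exact: mulmx1C. Qed.

Lemma orthogonal_trmx n (U : 'M[R]_n) : orthogonal_group U -> orthogonal_group U^T.
Proof. by move=> /orthogonal_mulmxT h; rewrite /orthogonal_group /= trmxK. Qed.

Lemma orthogonalM n (U V : 'M[R]_n) :
  orthogonal_group U -> orthogonal_group V -> orthogonal_group (U *m V).
Proof.
rewrite /orthogonal_group /= => hU hV.
by rewrite trmx_mul mulmxA -(mulmxA V^T) hU mulmx1 hV.
Qed.

Lemma measurable_frame_set m n (a : R) : measurable [set M : 'M[R]_(m, n) | M^T *m M = a%:M].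
Proof.
have -> : [set M : 'M[R]_(m, n) | M^T *m M = a%:M] =
    \bigcap_(i in [set: 'I_n]) \bigcap_(j in [set: 'I_n])
    (fun M : 'M[R]_(m, n) => (M^T *m M) i j) @^-1` [set (a%:M : 'M[R]_n) i j].
  apply/seteqP; split=> [U hU i _ j _|U hU]; first by rewrite /= hU.
  by apply/matrixP => i j; exact: hU.
apply: fin_bigcap_measurable => // i _; apply: fin_bigcap_measurable => // j _.
rewrite -[X in measurable X]setTI.
apply: measurable_fun_entry => //; apply: measurable_mulmx => //.
by apply: measurable_trmx.
Qed.

Lemma measurable_orthogonal_group n : measurable (@orthogonal_group R n).
Proof. exact: measurable_frame_set. Qed.

Lemma orthogonal_first_cols d r (le_rd : (r <= d)%N) (Q : 'M[R]_d) : orthogonal_group Q ->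
  (colsub (widen_ord le_rd) Q)^T *m colsub (widen_ord le_rd) Q = 1%:M.
Proof.
move=> OQ; apply/matrixP => i j.
have := congr1 (fun M : 'M[R]_d => M (widen_ord le_rd i) (widen_ord le_rd j)) OQ.
rewrite !mxE -val_eqE /= => <-.
by apply: eq_bigr => k _; rewrite !mxE.
Qed.

(* The reflection in the hyperplane orthogonal to [v - w] exchanges [v] and [w]. *)
Lemma orthogonal_transitive n (v w : 'cV[R]_n) : dot v v = dot w w ->
  exists2 U, orthogonal_group U & U^T *m v = w.
Proof.
move=> vw; have [->|nvw] := eqVneq v w.
  by exists 1%:M; rewrite /orthogonal_group /= trmx1 mul1mx.
pose z := v - w; pose c := 2 / dot z z.
have z0 : dot z z != 0.
  by apply: contra_neq nvw => /dot_eq0 /eqP; rewrite subr_eq0 => /eqP.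
pose H : 'M[R]_n := 1%:M - c *: (z *m z^T).
have HT : H^T = H by rewrite /H linearB linearZ/= trmx1 trmx_mul trmxK.
have zz : z^T *m z = (dot z z)%:M.
  by apply/matrixP => i j; rewrite !ord1 -dotE mxE eqxx mulr1n.
have HH : H *m H = 1%:M.
  have ZZ : (z *m z^T) *m (z *m z^T) = dot z z *: (z *m z^T).
    by rewrite -mulmxA (mulmxA z^T) zz mul_scalar_mx -scalemxAr.
  rewrite /H mulmxBl !mulmxBr !mul1mx mulmx1 -scalemxAl -scalemxAr ZZ !scalerA.
  rewrite -mulrA divfK//.
  by rewrite -scalerBl (_ : c - c * 2 = - c) ?scaleNr ?opprK ?subrK//; ring.
exists H; first by rewrite /orthogonal_group /= HT.
rewrite HT /H mulmxBl mul1mx -scalemxAl -mulmxA.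
have -> : z^T *m v = (dot z v)%:M.
  by apply/matrixP => i j; rewrite !ord1 -dotE mxE eqxx mulr1n.
rewrite mul_mx_scalar scalerA.
have -> : c * dot z v = 1.
  have e : dot z z = 2 * dot z v.
    rewrite /z !(dotDl, dotDr, dotNl, dotNr) -vw (dotC w v); ring.
  by rewrite /c mulrAC -e divff.
by rewrite scale1r /z subKr.
Qed.

End orthogonal.

(** The natural numbers supply as many distinct roots of [p - q] as its size. *)
Lemma horner_eq (R : numDomainType) (p q : {poly R}) : (forall x, p.[x] = q.[x]) -> p = q.
Proof.
move=> pq; apply/eqP; rewrite -subr_eq0; apply/eqP.
pose s : seq R := [seq i%:R | i <- iota 0 (size (p - q))].
apply: (@roots_geq_poly_eq0 _ _ s); last by rewrite size_map size_iota.
- by apply/allP => x _; rewrite rootE !hornerE pq subrr.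
- by rewrite map_inj_uniq ?iota_uniq//; exact: mulrIn (oner_neq0 R).
Qed.

(** Whenever one of the predecessors on exponents truncates, the factor [n%:R] or ['C(n, 2)%:R] in
    front of it vanishes. *)
Lemma coef2_trinomialX (R : comNzRingType) (x y z : R) n :
  let p := x%:P + y *: 'X + z *: 'X^2 in
  [/\ (p ^+ n)`_0 = x ^+ n, (p ^+ n)`_1 = n%:R * x ^+ n.-1 * y &
      (p ^+ n)`_2 = n%:R * x ^+ n.-1 * z + 'C(n, 2)%:R * x ^+ n.-2 * y ^+ 2].
Proof.
move=> p.
have p0 : p`_0 = x by rewrite !coefE /=; ring.
have p1 : p`_1 = y by rewrite !coefE /=; ring.
have p2 : p`_2 = z by rewrite !coefE /=; ring.
elim: n => [|n [IH0 IH1 IH2]]; first by rewrite !expr0 !coefE /= bin0n !mul0r addr0.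
rewrite exprS !coefM !big_ord_recr !big_ord0 /= !add0r p0 p1 p2 IH0 IH1 IH2.
case: n IH0 IH1 IH2 => [|[|n]] _ _ _ /=.
- by split; rewrite ?bin_small//; ring.
- by split; rewrite ?binS ?bin0 ?bin1 ?bin_small//; ring.
- split; first by rewrite -exprS.
    by rewrite -[in RHS]natr1 !exprS; ring.
  have -> : 'C(n.+3, 2)%:R = 'C(n.+2, 2)%:R + n.+2%:R :> R by rewrite binS bin1 natrD addrC.
  by rewrite -[n.+3%:R]natr1 !exprS; ring.
Qed.

(** For dimensions that are only propositionally equal: when [r = d], the frame is a square matrix
    in disguise. *)
Lemma mulmx1C_eq (R : comUnitRingType) m n (A : 'M[R]_(m, n)) (B : 'M[R]_(n, m)) :
  m = n -> B *m A = 1%:M -> A *m B = 1%:M.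
Proof. by move=> mn; subst n; exact: mulmx1C. Qed.

(** * Moments and tail of the squared projection *)

Section haar_projection.
Context {R : realType} (d r : nat) (le_rd : (r <= d)%N).
Variable nu : probability 'M[R]_d R.
Hypothesis haar : is_haar_orthogonal nu.
Implicit Types (U Q : 'M[R]_d) (v w e : 'cV[R]_d) (g h : 'M[R]_d -> R).

Local Notation O := (@orthogonal_group R d).

Let mO : measurable O. Proof. exact: measurable_orthogonal_group. Qed.

(** All integrands of this section are polynomial in the entries of [Q]. They are bounded on the
    orthogonal group only, which is why every integral is taken over [O]. *)
Let tame g := measurable_fun setT g /\ exists M, forall Q, O Q -> `|g Q| <= M.

Let tame_cst c : tame (fun=> c).
Proof. by split; [exact: measurable_cst|exists `|c|]. Qed.

Let tameD g h : tame g -> tame h -> tame (fun Q => g Q + h Q).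
Proof.
move=> [mg [M gM]] [mh [N hN]]; split; first exact: measurable_funD.
by exists (M + N) => Q OQ; rewrite (le_trans (ler_normD _ _))// lerD ?gM ?hN.
Qed.

Let tameM g h : tame g -> tame h -> tame (fun Q => g Q * h Q).
Proof.
move=> [mg [M gM]] [mh [N hN]]; split; first exact: measurable_funM.
by exists (M * N) => Q OQ; rewrite normrM ler_pM ?gM ?hN.
Qed.

Let tame_sum n (g : 'I_n -> 'M[R]_d -> R) :
  (forall i, tame (g i)) -> tame (fun Q => \sum_i g i Q).
Proof.
elim: n g => [|n IH] g tg.
  by under eq_fun do rewrite big_ord0; exact: tame_cst.
by under eq_fun do rewrite big_ord_recr/=; apply: tameD => //; exact: IH.
Qed.

Let tameX g n : tame g -> tame (fun Q => g Q ^+ n).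
Proof.
move=> tg; elim: n => [|n IH]; first by under eq_fun do rewrite expr0; exact: tame_cst.
by under eq_fun do rewrite exprS; exact: tameM.
Qed.

Let tame_entry i j : tame (fun Q => Q i j).
Proof.
split; first exact: measurable_mx_entry.
exists 1 => Q OQ; rewrite -(expr_le1 (n := 2))// real_normK ?num_real//.
have : (Q^T *m Q) j j = 1 by rewrite OQ mxE eqxx.
rewrite mxE => <-; rewrite (bigD1 i)//= mxE expr2 lerDl sumr_ge0// => k _.
by rewrite mxE -expr2 sqr_ge0.
Qed.

Let tame_integrable g : tame g -> nu.-integrable O (EFin \o g).
Proof.
move=> [mg [M gM]]; apply: measurable_bounded_integrable => //.
- by rewrite -ge0_fin_numE// fin_num_measure.
- exact: measurable_funTS.
- exists M; split; first exact: num_real.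
  by move=> N MN Q OQ /=; rewrite (le_trans (gM _ OQ))// ltW.
Qed.

Let E g := \int[nu]_(Q in O) g Q.

Let E_sum n (g : 'I_n -> 'M[R]_d -> R) : (forall i, tame (g i)) ->
  E (fun Q => \sum_i g i Q) = \sum_i E (g i).
Proof.
elim: n g => [|n IH] g tg.
  by rewrite big_ord0 /E; under eq_Rintegral do rewrite big_ord0; rewrite Rintegral_cst// mul0r.
rewrite big_ord_recr -IH// /E; under eq_Rintegral do rewrite big_ord_recr.
by rewrite RintegralD//; apply: tame_integrable => //; exact: tame_sum.
Qed.

Let EZ c g : tame g -> E (fun Q => c * g Q) = c * E g.
Proof. by move=> tg; rewrite /E RintegralZl//; exact: tame_integrable. Qed.

Let E_mulmx U g : O U -> tame g -> (forall Q, 0 <= g Q) -> E (fun Q => g (U *m Q)) = E g.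
Proof.
move=> OU [mg _] g0; rewrite /E /Rintegral; congr fine.
have mU : measurable_fun setT (mulmx U : 'M[R]_d -> 'M[R]_d).
  by apply: measurable_mulmx => //; exact: measurable_cst.
pose phi : {mfun 'M[R]_d >-> 'M[R]_d} := HB.pack (mulmx U : 'M[R]_d -> 'M[R]_d)
  (isMeasurableFun.Build _ _ _ _ _ mU).
transitivity (\int[distribution nu phi]_(Q in O) (g Q)%:E)%E; last first.
  by apply: eq_measure_integral => A mA _; exact: haar.2.
rewrite ge0_integral_pushforward//=; last 2 first.
  by apply/measurable_EFinP; exact: measurable_funTS.
  by move=> y _; rewrite lee_fin.
congr (integral _ _ _); apply/seteqP; split => Q /=; first exact: orthogonalM.
by move/(orthogonalM (orthogonal_trmx OU)); rewrite mulmxA OU mul1mx.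
Qed.

Let frame Q : 'M[R]_(d, r) := colsub (widen_ord le_rd) Q.

Let frame_mulmx U Q : frame (U *m Q) = U *m frame Q.
Proof. by apply/matrixP => i j; rewrite !mxE; apply: eq_bigr => k _; rewrite mxE. Qed.

Let frame_orth Q : O Q -> (frame Q)^T *m frame Q = 1%:M.
Proof. exact: orthogonal_first_cols. Qed.

(* [proj_dot Q v v] is the squared norm of the orthogonal projection of [v] on the span of the
   first [r] columns of [Q], when [Q] is orthogonal. *)
Definition proj_dot Q v w : R := dot ((frame Q)^T *m v) ((frame Q)^T *m w).

Local Notation proj_sqr Q v := (proj_dot Q v v).

Let tame_proj v w : tame (fun Q => proj_dot Q v w).
Proof.
rewrite /proj_dot /dot; apply: tame_sum => j; apply: tameM.
  under eq_fun do rewrite mxE; apply: tame_sum => k; apply: tameM => //.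
  by under eq_fun do rewrite !mxE; exact: tame_entry.
under eq_fun do rewrite mxE; apply: tame_sum => k; apply: tameM => //.
by under eq_fun do rewrite !mxE; exact: tame_entry.
Qed.

Let proj_dotE Q v w : proj_dot Q v w = dot v (frame Q *m (frame Q)^T *m w).
Proof. by rewrite /proj_dot dot_mulmx trmxK mulmxA. Qed.

Let proj_trace Q : O Q -> \sum_i proj_sqr Q (delta_mx i 0) = r%:R.
Proof.
move=> OQ.
transitivity (\tr ((frame Q)^T *m frame Q)); last by rewrite frame_orth// mxtrace1.
rewrite mxtrace_mulC; apply: eq_bigr => i _.
by rewrite proj_dotE dotC dot_delta -colE mxE.
Qed.

Let proj_parseval Q e : O Q -> \sum_i proj_dot Q e (delta_mx i 0) ^+ 2 = proj_sqr Q e.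
Proof.
move=> OQ; set a := (frame Q)^T *m e.
transitivity (dot (frame Q *m a) (frame Q *m a)).
  by apply: eq_bigr => i _; rewrite /proj_dot -/a -dot_mulmx dot_delta expr2.
by rewrite dot_mulmx mulmxA frame_orth// mul1mx.
Qed.

Lemma proj_sqr_bounds Q v : O Q -> 0 <= proj_sqr Q v <= dot v v.
Proof.
move=> OQ; rewrite dot_ge0/= -subr_ge0.
have := dot_ge0 (v - frame Q *m ((frame Q)^T *m v)).
set a := (frame Q)^T *m v; rewrite !(dotDl, dotDr, dotNl, dotNr).
have -> : dot (frame Q *m a) (frame Q *m a) = dot a a.
  by rewrite dot_mulmx mulmxA frame_orth// mul1mx.
by rewrite (dotC v) dot_mulmx -/a /proj_dot -/a; lra.
Qed.

Let moment n v : R := E (fun Q => proj_sqr Q v ^+ n).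

(** Left invariance and transitivity on spheres: replacing [Q] by [U *m Q] amounts to replacing [v]
    by [U^T *m v]. *)
Let moment_invariant n v w : dot v v = dot w w -> moment n v = moment n w.
Proof.
move=> /orthogonal_transitive[U OU <-].
rewrite /moment -(E_mulmx OU)//; last 2 first.
- exact/tameX/tame_proj.
- by move=> Q; rewrite exprn_ge0// dot_ge0.
by congr E; apply/funext => Q; rewrite /proj_dot frame_mulmx trmx_mul -mulmxA.
Qed.

Let momentE n e v : dot e e = 1 -> moment n v = dot v v ^+ n * moment n e.
Proof.
move=> e1; pose s := enorm v.
have s2 : s ^+ 2 = dot v v by exact: enorm_sqr.
rewrite (@moment_invariant n v (s *: e)); last by rewrite dotZl dotZr e1 mulr1 -expr2 s2.
rewrite /moment -EZ; last exact/tameX/tame_proj.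
congr E; apply/funext => Q; rewrite -exprMn -s2; congr (_ ^+ _).
by rewrite /proj_dot -scalemxAr dotZl dotZr mulrA -expr2.
Qed.

Let moment0 e : moment 0 e = 1.
Proof.
rewrite /moment /E; under eq_Rintegral do rewrite expr0.
by rewrite Rintegral_cst// mul1r; exact: (congr1 fine haar.1).
Qed.

(* The moment recursion of the Beta distribution with parameters [r / 2] and [(d - r) / 2]. *)
Let momentS n e : dot e e = 1 ->
  (d + 2 * n)%:R * moment n.+1 e = (r + 2 * n)%:R * moment n e.
Proof.
move=> e1.
pose c2 i Q := n.+1%:R * (proj_sqr Q e ^+ n * proj_sqr Q (delta_mx i 0)) +
  ('C(n.+1, 2)%:R * 4) * (proj_sqr Q e ^+ n.-1 * proj_dot Q e (delta_mx i 0) ^+ 2).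
have tc2 i : tame (c2 i).
  by apply: tameD; apply: tameM => //; apply: tameM; do ?[exact: tameX|exact: tame_proj].
(* The coefficients of degree 2 in [s] of both sides of [momentE] at [e + s e_i]. *)
have Ec2 i : E (c2 i) = moment n.+1 e * (n.+1%:R + 'C(n.+1, 2)%:R * 4 * e i 0 ^+ 2).
  pose p Q : {poly R} := (proj_sqr Q e)%:P + (2 * proj_dot Q e (delta_mx i 0)) *: 'X +
    proj_sqr Q (delta_mx i 0) *: 'X^2.
  have tp1 k : tame (fun Q => (p Q)`_k).
    have -> : (fun Q => (p Q)`_k) = (fun Q => (k == 0)%:R * proj_sqr Q e +
        (k == 1)%:R * (2 * proj_dot Q e (delta_mx i 0)) +
        (k == 2)%:R * proj_sqr Q (delta_mx i 0)).
      apply/funext => Q; rewrite !coefE.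
      by case: k => [|[|[|k]]] /=; ring.
    by apply: tameD; [apply: tameD|]; do ?[apply: tameM => //]; exact: tame_proj.
  have tp k m : tame (fun Q => (p Q ^+ m)`_k).
    elim: m k => [|m IH] k.
      by under eq_fun do rewrite expr0; exact: tame_cst.
    under eq_fun do rewrite exprS coefM; apply: tame_sum => j; apply: tameM => //.
  pose N := (2 * n.+1).+1.
  have sp Q : (size (p Q ^+ n.+1) <= N)%N.
    rewrite (leq_trans (size_poly_exp_leq _ _))// ltnS leq_mul2r; apply/orP; right.
    have : (size (p Q) <= 3)%N.
      by apply/leq_sizeP => -[|[|[|k]]]// _; rewrite !coefE /=; ring.
    by case: (size _) => [|[|[|[]]]].
  pose q : {poly R} := 1%:P + (2 * e i 0) *: 'X + 1 *: 'X^2.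
  (* In [s], both sides are polynomials with the same value at every point, so expectations may be
     compared coefficient by coefficient without differentiating under the integral. *)
  have peq : \poly_(k < N) E (fun Q => (p Q ^+ n.+1)`_k) = moment n.+1 e *: q ^+ n.+1.
    apply: horner_eq => s; rewrite horner_poly hornerZ horner_exp.
    have -> : q.[s] = dot (e + s *: delta_mx i 0) (e + s *: delta_mx i 0).
      rewrite !(dotDl, dotDr, dotZl, dotZr) e1 (dotC (delta_mx i 0)) !dot_delta mxE !eqxx.
      by rewrite /q !hornerE /=; ring.
    rewrite mulrC -momentE// /moment.
    transitivity (E (fun Q => \sum_(k < N) s ^+ k * (p Q ^+ n.+1)`_k)).
      rewrite E_sum => [|k]; last exact: tameM.
      by apply: eq_bigr => k _; rewrite EZ// mulrC.
    congr E; apply/funext => Q.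
    under eq_bigr do rewrite mulrC.
    rewrite -horner_coef_wide// horner_exp; congr (_ ^+ _).
    rewrite /p !hornerE/= /proj_dot !mulmxDr -!scalemxAr !(dotDl, dotDr, dotZl, dotZr).
    by rewrite (dotC ((frame Q)^T *m delta_mx i 0)); ring.
  have := congr1 (fun u : {poly R} => u`_2) peq; rewrite coef_poly coefZ /=.
  have -> : (2 < N)%N by rewrite /N mulnS.
  have [_ _ ->] := coef2_trinomialX 1 (2 * e i 0) 1 n.+1.
  rewrite !expr1n => peq2.
  transitivity (E (fun Q => (p Q ^+ n.+1)`_2)); last by rewrite peq2; ring.
  congr E; apply/funext => Q.
  have [_ _ ->] := coef2_trinomialX (proj_sqr Q e) (2 * proj_dot Q e (delta_mx i 0))
    (proj_sqr Q (delta_mx i 0)) n.+1.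
  by rewrite /c2/=; ring.
(* Summed over the basis, the squared projections give the trace [r] of the projector, and the
   squared cross terms give back [proj_sqr Q e] by Parseval. *)
have sumc2 : E (fun Q => \sum_i c2 i Q) =
    (n.+1%:R * r%:R + 'C(n.+1, 2)%:R * 4) * moment n e.
  rewrite /moment -EZ; last exact: tameX.
  apply: eq_Rintegral => Q; rewrite inE => OQ.
  rewrite big_split/= -!mulr_sumr proj_trace// proj_parseval//.
  case: n {Ec2 tc2 c2} => [|m]; first by rewrite bin_small//; ring.
  by rewrite /= -exprSr; ring.
(* With this, [n.+1] cancels, leaving [d + 2 n] on one side and [r + 2 n] on the other. *)
have bin2n : 'C(n.+1, 2)%:R * 4 = n.+1%:R * (2 * n%:R) :> R.
  elim: (n) => [|m IH]; first by rewrite bin_small//; ring.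
  by rewrite binS bin1 natrD mulrDl IH -[m.+2%:R]natr1 -[m.+1%:R]natr1; ring.
have n0 : n.+1%:R != 0 :> R by rewrite pnatr_eq0.
apply: (mulfI n0); move: sumc2; rewrite E_sum//.
under eq_bigr do rewrite Ec2.
rewrite -mulr_sumr big_split/= sumr_const card_ord -mulr_sumr.
have -> : \sum_i e i 0 ^+ 2 = 1 by rewrite -e1; apply: eq_bigr => i _; rewrite expr2.
rewrite bin2n mulr1 -mulr_natr => h.
rewrite [(d + _)%:R]natrD [(r + _)%:R]natrD natrM.
by apply: etrans (etrans _ h) _; ring.
Qed.

Lemma measurable_proj_ge v c : measurable [set Q | c <= proj_sqr Q v].
Proof.
rewrite -[X in measurable X]setTI -preimage_itvcy.
by apply: (tame_proj v v).1 => //; exact: measurable_itv.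
Qed.

(** After normalising [v], [momentS] is the recursion [beta_momentS] with both factors doubled, so
    the comparison applies at [t]. Two cases stand apart: [v = 0], where the inequality always
    holds, and [r = d], where the projection is the identity. *)
Lemma haar_proj_tail v : (0 < r)%N ->
  ((mu_const d r)%:E <=
   nu (O `&` [set Q | (r%:R / (2 * d%:R) * dot v v <= proj_dot Q v v)%R]))%E.
Proof.
move=> r0; have d0 : (0 < d)%N by exact: leq_trans le_rd.
have dR : 0 < d%:R :> R by rewrite ltr0n.
have rR : 0 < r%:R :> R by rewrite ltr0n.
set t : R := r%:R / (2 * d%:R).
have rd : r%:R <= d%:R :> R by rewrite ler_nat.
have t0 : 0 < t by rewrite divr_gt0// mulr_gt0.
have t1 : t < 1 by rewrite ltr_pdivrMr ?mulr_gt0// mul1r; lra.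
have nuO : nu O = 1%E := haar.1.
have mY w : measurable_fun setT (fun Q => proj_sqr Q w) by have [] := tame_proj w w.
have mu1 : mu_const d r <= 1 :> R.
  rewrite /mu_const; case: ifPn => // _; rewrite gerBl.
  by rewrite divr_ge0// Rintegral_ge0// => x _; rewrite mulr_ge0// powR_ge0.
have [v0|v0] := eqVneq (dot v v) 0.
  rewrite v0 mulr0 (_ : _ `&` _ = O) ?nuO ?lee_fin//.
  by apply/setIidPl => Q OQ /=; rewrite dot_ge0.
rewrite /mu_const; case: ifPn => rltd; last first.
  rewrite (_ : _ `&` _ = O) ?nuO//; apply/setIidPl => Q OQ /=.
  have rE : d = r by apply/eqP; rewrite eqn_leq le_rd leqNgt rltd.
  rewrite proj_dotE (mulmx1C_eq rE (frame_orth OQ)) mul1mx.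
  by rewrite ler_piMl ?dot_ge0// ltW.
have vpos : 0 < dot v v by rewrite lt_def v0 dot_ge0.
have s0 : enorm v != 0 by rewrite -sqrf_eq0 enorm_sqr.
pose e := (enorm v)^-1 *: v.
have e1 : dot e e = 1.
  by rewrite /e dotZl dotZr -enorm_sqr expr2; field.
have ve Q : proj_sqr Q e = proj_sqr Q v / dot v v.
  by rewrite /proj_dot /e -scalemxAr dotZl dotZr -(enorm_sqr v); field.
pose a : R := r%:R / 2; pose b : R := (d%:R - r%:R) / 2.
have a2 : 2^-1 <= a by rewrite /a ler_pdivlMr// mulVf// ler1n.
have b2 : 2^-1 <= b by rewrite /b ler_pdivlMr// mulVf// -natrB// ler1n subn_gt0.
have mom i : \int[nu]_(Q in O) (proj_sqr Q e) ^+ i = beta_moment a b i.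
  have h : moment i e = beta_moment a b i.
    elim: i => [|i IH]; first by rewrite moment0 beta_moment0.
    have abi : a + b + i%:R = (d + 2 * i)%:R / 2 by rewrite natrD natrM /a /b; field.
    have ai : a + i%:R = (r + 2 * i)%:R / 2 by rewrite natrD natrM /a; field.
    have n0 : a + b + i%:R != 0 by rewrite abi mulf_neq0// pnatr_eq0 -lt0n addn_gt0 d0.
    apply: (mulfI n0); rewrite beta_momentS// -IH abi ai.
    by rewrite mulrAC momentS// mulrAC.
  exact: h.
have tail := le_reg_incomplete_beta_of_moments a2 b2 (nu := nu) (D := O)
  (Y := fun Q => proj_sqr Q e) (t := t).
have {}tail : (nu (O `&` [set Q | (proj_sqr Q e < t)%R]) <= (reg_incomplete_beta t a b)%:E)%E.
  apply: tail => //.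
  - by rewrite t0 t1.
  - exact: measurable_funTS.
  - by move=> Q OQ; rewrite -e1 proj_sqr_bounds.
have mlt : measurable (O `&` [set Q | proj_sqr Q e < t]).
  by rewrite -preimage_itvNyo; apply: measurable_funTS => //; exact: measurable_itv.
rewrite (_ : O `&` _ = O `\` (O `&` [set Q | proj_sqr Q e < t])); last first.
  apply/seteqP; split => Q /=.
    move=> [OQ vQ]; split => // -[_]; rewrite ve ltr_pdivrMr// ltNge.
    by rewrite vQ.
  move=> [OQ h]; split=> //; rewrite leNgt; apply/negP => h'; apply: h; split => //.
  by rewrite ve ltr_pdivrMr.
rewrite measureD//; last by rewrite -ge0_fin_numE// fin_num_measure.
rewrite setIA setIid EFinB leeB//.
exact: (eq_ind_r (fun x => 1%:E <= x)%E (lexx _) nuO).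
Qed.

End haar_projection.

(** * Sub-Gaussian vectors *)

(* For [y <= 1/2] this follows from [expR y <= (1 - y)^-1]. *)
Lemma expR_le_quadratic (R : realType) (y : R) : expR y <= y + expR (2 * y ^+ 2).
Proof.
have [y2|y2] := leP y 2^-1; last first.
  apply: (@le_trans _ _ (expR (2 * y ^+ 2))); last by rewrite lerDr; lra.
  rewrite ler_expR; nra.
have y1 : 0 < 1 - y by lra.
apply: (@le_trans _ _ (1 + y + 2 * y ^+ 2)); last first.
  by have := expR_ge1Dx (2 * y ^+ 2); lra.
have h : expR y * (1 - y) <= 1.
  by rewrite -[leRHS](expRxMexpNx_1 y) ler_wpM2l ?expR_ge0// expR_ge1Dx.
rewrite -(ler_pM2r y1); apply: le_trans h _; nra.
Qed.

Section sub_gaussian_noise.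
Local Open Scope ereal_scope.
Context {R : realType} d (Xi : measurableType d) (D : probability Xi R) (m : nat).
Variables (g : Xi -> 'cV[R]_m) (s2 : R).
Hypotheses (mg : measurable_fun setT g) (s2_gt0 : (0 < s2)%R).
Hypothesis g_centered : forall i, D.-integrable setT (fun z => (g z i 0)%:E) /\
  \int[D]_z (g z i 0)%:E = 0.
Hypothesis g_subg : forall c : R, (0 <= c)%R -> (c * s2 <= 1)%R ->
  \int[D]_z (expR (c * dot (g z) (g z)))%:E <= (expR (c * s2))%:E.
Implicit Types (v w : 'cV[R]_m) (a c : R).

Let mgg : measurable_fun setT (fun z => dot (g z) (g z)).
Proof. exact: measurable_dot. Qed.

Let mwg w : measurable_fun setT (fun z => dot w (g z)).
Proof. by apply: measurable_dot => //; exact: measurable_cst. Qed.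

Let mexp (h : Xi -> R) : measurable_fun setT h -> measurable_fun setT (fun z => (expR (h z))%:E).
Proof. by move=> mh; apply/measurable_EFinP; exact: measurableT_comp. Qed.

Let integral_dot w : D.-integrable setT (fun z => (dot w (g z))%:E) /\
  \int[D]_z (dot w (g z))%:E = 0.
Proof.
have iZ i : D.-integrable setT (fun z => (w i 0)%:E * (g z i 0)%:E).
  by apply: integrableZl => //; exact: (g_centered i).1.
have -> : (fun z => (dot w (g z))%:E) = (fun z => \sum_i (w i 0)%:E * (g z i 0)%:E).
  by apply/funext => z; rewrite -sumEFin; apply: eq_bigr.
split; first exact: integrable_sum.
rewrite integral_sum// big1// => i _.
rewrite integralZl//; last exact: (g_centered i).1.
by rewrite (g_centered i).2 mule0.
Qed.

(** Holds for [w] of any length, whereas [g_subg] restricts [c]: it will be applied to a multiple of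
    the sum of the earlier noise vectors, which is unbounded. *)
Let mgf_le w : \int[D]_z (expR (dot w (g z)))%:E <= (expR (2 * dot w w * s2))%:E.
Proof.
(* When [2 |w|^2 s2 <= 1] the linear term of [expR_le_quadratic] has zero mean; otherwise
   Young's inequality [<w, g> <= s2 |w|^2 + |g|^2 / (4 s2)] is enough. *)
set c := dot w w; have c0 : (0 <= c)%R by exact: dot_ge0.
have [c1|c1] := leP (2 * c * s2)%R 1%R.
  have [iw iw0] := integral_dot w.
  apply: (@le_trans _ _ (\int[D]_z ((dot w (g z))%:E + (expR (2 * c * dot (g z) (g z)))%:E))).
    apply: ge0_le_integral => //.
    - exact: mexp.
    - apply: emeasurable_funD; first by apply/measurable_EFinP.
      by apply: mexp; exact: measurable_funM.
    move=> z _; rewrite -EFinD lee_fin.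
    apply: le_trans (expR_le_quadratic _) _; rewrite lerD2l ler_expR -mulrA.
    by rewrite ler_pM2l// sqr_dot_le.
  have c20 : (0 <= 2 * c)%R by rewrite mulr_ge0.
  rewrite integralD//; first by rewrite iw0 add0e; exact: g_subg.
  apply/integrableP; split; first by apply: mexp; exact: measurable_funM.
  apply: le_lt_trans (ltry (expR (2 * c * s2))).
  under eq_integral do rewrite gee0_abs ?lee_fin ?expR_ge0//.
  exact: g_subg.
apply: (@le_trans _ _ (\int[D]_z ((expR (c * s2))%:E * (expR ((4 * s2)^-1 * dot (g z) (g z)))%:E))).
  apply: ge0_le_integral => //.
  - exact: mexp.
  - by apply: emeasurable_funM => //; apply: mexp; exact: measurable_funM.
  move=> z _; rewrite -EFinM -expRD lee_fin ler_expR.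
  have s4 : (0 < 4 * s2)%R by rewrite mulr_gt0.
  rewrite -(ler_pM2l s4) mulrDr (mulrA _ (_^-1)%R) mulfV ?gt_eqF// mul1r.
  have := dot_ge0 ((2 * s2) *: w - g z).
  by rewrite !(dotDl, dotDr, dotNl, dotNr, dotZl, dotZr) (dotC (g z) w) -/c; lra.
rewrite ge0_integralZl//; last by apply: mexp; exact: measurable_funM.
apply: (@le_trans _ _ ((expR (c * s2))%:E * (expR ((4 * s2)^-1 * s2))%:E)).
  rewrite lee_pmul2l ?lte_fin ?expR_gt0//; apply: g_subg.
  - by rewrite invr_ge0 mulr_ge0// ltW.
  - by rewrite invfM mulfVK ?gt_eqF//; lra.
rewrite -EFinM lee_fin -expRD ler_expR invfM mulfVK ?gt_eqF//; lra.
Qed.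

(* Adding a sample to a sum of noise vectors costs only [expR K^-1] once the variance proxy of
   the squared norm is relaxed from [s2 * K] to [s2 * (K + 16)]. *)
Lemma exp_sqr_norm_le v K : (1 <= K)%R ->
  \int[D]_z (expR (dot (v + g z) (v + g z) / (s2 * (K + 16))))%:E <=
  (expR (dot v v / (s2 * K) + K^-1))%:E.
Proof.
move=> K1; set a : R := (s2 * (K + 16))^-1%R.
have a0 : (0 < a)%R by rewrite invr_gt0 mulr_gt0//; lra.
have as2 : (a * s2 = (K + 16)^-1)%R by rewrite /a invfM mulrAC mulVf ?mul1r// gt_eqF.
(* [2 * A] is the exponent given by [mgf_le] at [4 a v], and [2 * b] the one given by [g_subg] at
   [2 a]; the coefficients 4 and 2 are twice those of the expanded square. *)
pose A : R := (16 * a ^+ 2 * dot v v * s2)%R.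
pose b : R := (a * s2)%R.
(* Weighted AM-GM on the cross term and the square term of [dot (v + g z) (v + g z)]; the
   weights [b - A] and [A - b] balance the two resulting moments. *)
have dec z : (expR (dot (v + g z) (v + g z) * a) <=
    expR (a * dot v v) * (2^-1 * expR (b - A) * expR (dot ((4 * a) *: v) (g z)) +
      2^-1 * expR (A - b) * expR (2 * a * dot (g z) (g z))))%R.
  set p := dot ((4 * a) *: v) (g z); set q := (2 * a * dot (g z) (g z))%R.
  rewrite -!mulrA -!expRD -mulrDr.
  have -> : (dot (v + g z) (v + g z) * a = a * dot v v + ((b - A + p) / 2 + (A - b + q) / 2))%R.
    by rewrite /p /q dotZl !(dotDl, dotDr) (dotC (g z) v); field.
  rewrite [leLHS]expRD ler_wpM2l ?expR_ge0// [leLHS]expRD.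
  have half (x : R) : (expR x = expR (x / 2) ^+ 2)%R.
    by rewrite expr2 -expRD; congr expR; field.
  rewrite (half (b - A + p))%R (half (A - b + q))%R.
  by have := sqr_ge0 (expR ((b - A + p) / 2) - expR ((A - b + q) / 2))%R; nra.
have mp : measurable_fun setT (fun z => dot ((4 * a) *: v) (g z)) by exact: mwg.
have mq : measurable_fun setT (fun z => 2 * a * dot (g z) (g z))%R by exact: measurable_funM.
apply: (@le_trans _ _ (\int[D]_z ((expR (a * dot v v))%:E *
   ((2^-1 * expR (b - A))%:E * (expR (dot ((4 * a) *: v) (g z)))%:E +
    (2^-1 * expR (A - b))%:E * (expR (2 * a * dot (g z) (g z)))%:E)))).
  apply: ge0_le_integral => //.
  - apply: mexp; apply: measurable_funM => //; apply: measurable_dot;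
    by apply: measurable_addmx => //; exact: measurable_cst.
  - apply: emeasurable_funM => //; apply: emeasurable_funD;
    by apply: emeasurable_funM => //; exact: mexp.
  - by move=> z _; have := dec z; rewrite -lee_fin !EFinM EFinD !EFinM; apply.
have h0 x : (0 <= 2^-1 * expR x)%R by rewrite mulr_ge0// expR_ge0.
have e0 x y : 0 <= (2^-1 * expR x)%:E * (expR y)%:E :> \bar R.
  by rewrite -EFinM lee_fin mulr_ge0.
have me x (h : Xi -> R) : measurable_fun setT h ->
    measurable_fun setT (fun z => (2^-1 * expR x)%:E * (expR (h z))%:E).
  by move=> mh; apply: measurable_funeM; exact: mexp.
rewrite ge0_integralZl//; [|exact: emeasurable_funD (me _ _ mp) (me _ _ mq)|
  by move=> z _; exact: adde_ge0].
rewrite (ge0_integralD _ _ _ (me _ _ mp) _ (me _ _ mq))//.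
rewrite (ge0_integralZl _ _ (mexp mp))// (ge0_integralZl _ _ (mexp mq))//.
have hp : \int[D]_z (expR (dot ((4 * a) *: v) (g z)))%:E <= (expR (2 * A))%:E.
  apply: le_trans (mgf_le _) _; rewrite dotZl dotZr lee_fin ler_expR /A; lra.
have hq : \int[D]_z (expR (2 * a * dot (g z) (g z)))%:E <= (expR (2 * b))%:E.
  have -> : (2 * b = 2 * a * s2)%R by rewrite /b mulrA.
  apply: g_subg; first by rewrite mulr_ge0// ltW.
  by rewrite -mulrA as2 ler_pdivrMr; lra.
apply: (@le_trans _ _ ((expR (a * dot v v))%:E * ((2^-1 * expR (b - A))%:E * (expR (2 * A))%:E +
    (2^-1 * expR (A - b))%:E * (expR (2 * b))%:E))).
  by rewrite lee_wpmul2l ?lee_fin ?expR_ge0// leeD// lee_wpmul2l// lee_fin.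
have -> : (expR (dot v v / (s2 * K) + K^-1) = expR (dot v v / (s2 * K) + K^-1 - (a * dot v v + A + b)) *
    (expR (a * dot v v) * (2^-1 * expR (b - A) * expR (2 * A) +
      2^-1 * expR (A - b) * expR (2 * b))))%R.
  rewrite -!(mulrA 2^-1)%R -!expRD -mulrDr.
  have -> : (b - A + 2 * A = A + b)%R by ring.
  have -> : (A - b + 2 * b = A + b)%R by ring.
  have -> : (2^-1 * (expR (A + b) + expR (A + b)) = expR (A + b))%R by field.
  by rewrite -!expRD; congr expR; ring.
set M := (expR (a * _) * _)%R.
suff h : (1 <= expR (dot v v / (s2 * K) + K^-1 - (a * dot v v + A + b)))%R.
  have M0 : (0 <= M)%R.
    by rewrite mulr_ge0// addr_ge0// mulr_ge0.
  by apply: (@le_trans _ _ M%:E); [exact: lexx|rewrite lee_fin ler_peMl].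
rewrite -expR0 ler_expR subr_ge0.
have K0 : (0 < K)%R by lra.
have K16 : (0 < K + 16)%R by lra.
apply: lerD; last by rewrite /b as2 lef_pV2 ?posrE//; lra.
(* With an increment [h] in place of 16, the requirement reads [K (K + h + 16) <= (K + h)^2], that
   is [(16 - h) K <= h^2]; 16 is the least [h] that works for arbitrarily large [K]. *)
have -> : (a * dot v v + A = dot v v / s2 * ((K + 32) / (K + 16) ^+ 2))%R.
  by rewrite /A /a; field; rewrite !gt_eqF.
have -> : (dot v v / (s2 * K) = dot v v / s2 * K^-1)%R by rewrite invfM mulrA.
apply: ler_wpM2l; first by rewrite divr_ge0 ?dot_ge0// ltW.
by rewrite ler_pdivrMr ?exprn_gt0// mulrC ler_pdivlMr//; nra.
Qed.

End sub_gaussian_noise.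

(** * Descent inequality *)

Section descent.
Context {R : realType} (n : nat).
Implicit Types (F : 'cV[R]_n -> R) (x y h : 'cV[R]_n).

Lemma derive_gradient F x h : differentiable F x -> 'D_h F x = dot (gradient F x) h.
Proof.
move=> dF; rewrite deriveE//.
have {1}-> : h = \sum_i h i 0 *: delta_mx i 0.
  by rewrite [LHS]matrix_sum_delta; apply: eq_bigr => i _; rewrite big_ord1.
rewrite linear_sum; apply: eq_bigr => i _.
by rewrite linearZ /= mxE deriveE// mulrC.
Qed.

Lemma enormZ (a : R) x : enorm (a *: x) = `|a| * enorm x.
Proof.
apply/eqP; rewrite -(eqrXn2 (n := 2))// ?mulr_ge0 ?enorm_ge0//.
by rewrite exprMn real_normK ?num_real// !enorm_sqr dotZl dotZr mulrA -expr2.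
Qed.

Let is_derive_line F x h (t : R) : differentiable F (x + t *: h) ->
  is_derive t (1 : R) (fun s => F (x + s *: h)) (dot (gradient F (x + t *: h)) h).
Proof.
move=> dF; have dF' : derivable F (x + t *: h) h by exact: diff_derivable.
have e : (fun s : R => s^-1 *: (((fun s => F (x + s *: h)) \o shift t) (s *: (1 : R)) -
      F (x + t *: h))) =
    (fun s : R => s^-1 *: ((F \o shift (x + t *: h)) (s *: h) - F (x + t *: h))).
  apply/funext => s; congr (_ *: (F _ - _)).
  have -> : s *: (1 : R) = s by rewrite /GRing.scale /= mulr1.
  by rewrite /= scalerDl addrCA.
split; first by rewrite /derivable e.
by rewrite -derive_gradient// /derive e.
Qed.

(** The mean value theorem for [F] minus its quadratic model along the segment: the derivative of
    this difference is at most 0 by smoothness, so no integral of the gradient appears. *)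
Lemma smooth_descent F (L : R) x y : (forall z, differentiable F z) -> smooth L F ->
  F y <= F x + dot (gradient F x) (y - x) + L / 2 * dot (y - x) (y - x).
Proof.
move=> dF sF; set h := y - x.
pose g (t : R) : R := F (x + t *: h) - (t * dot (gradient F x) h + t ^+ 2 * (L / 2 * dot h h)).
pose g' (t : R) : R := dot (gradient F (x + t *: h)) h -
  (dot (gradient F x) h + t * (L * dot h h)).
have dg : forall t : R, is_derive t (1 : R) g (g' t).
  move=> t; have dl := is_derive_line (dF (x + t *: h)).
  by apply: is_derive_eq; rewrite /g' /GRing.scale /=; field.
have [|t t01 gt] := @MVT R g g' 0 1 ltr01 (fun t _ => dg t).
  apply: derivable_within_continuous => t _; by have [] := dg t.
have t0 : 0 < t by move: t01; rewrite in_itv/= => /andP[].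
have bound : dot (gradient F (x + t *: h) - gradient F x) h <= t * (L * dot h h).
  apply: le_trans (ler_norm _) _; apply: le_trans (dot_le_enorm _ _) _.
  rewrite -enorm_sqr expr2 !mulrA ler_wpM2r ?enorm_ge0//.
  have := sF (x + t *: h) x; rewrite (addrAC x) subrr add0r => /le_trans; apply.
  by rewrite (enormZ t) gtr0_norm// mulrCA mulrA.
rewrite -[y](_ : x + 1 *: h = y); last by rewrite scale1r /h addrC subrK.
move: gt bound; rewrite /g /g' dotDl dotNl subr0 mulr1 scale0r addr0.
lra.
Qed.

Variables (r : nat) (P : 'M[R]_(n, r)) (c : R).
Hypotheses (c0 : 0 < c) (PP : P^T *m P = c%:M).

(** [c^-1 P P^T] is an orthogonal projection; the residual [c e - P P^T e] has nonnegative squared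
    norm. *)
Lemma enorm_trmx_frame_le (e : 'cV[R]_n) : enorm (P^T *m e) ^+ 2 <= c * enorm e ^+ 2.
Proof.
rewrite !enorm_sqr; set u := P^T *m e.
have Pu : dot (P *m u) (P *m u) = c * dot u u.
  by rewrite dot_mulmx mulmxA PP mul_scalar_mx dotZr.
have eP : dot e (P *m u) = dot u u by rewrite dotC dot_mulmx.
have := dot_ge0 (c *: e - P *m u).
rewrite !(dotDl, dotDr, dotNl, dotNr, dotZl, dotZr) Pu (dotC _ e) eP => h.
by rewrite -(ler_pM2l c0); lra.
Qed.

(** With [u = P^T g] and [w = P^T grad F(x)], this stepsize makes the change in the model
    [- eta <u, w> + eta |u|^2 / 2], that is [eta / 2 * (|u - w|^2 - |w|^2)]. The noise separates
    without a cross term, for any vector [g]. *)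
Lemma subspace_descent F (L : R) x (g : 'cV[R]_n) : 0 < L ->
  (forall z, differentiable F z) -> smooth L F ->
  F (x - (L * c)^-1 *: (P *m P^T *m g)) <=
    F x - (L * c)^-1 / 2 * enorm (P^T *m gradient F x) ^+ 2 +
    (L * c)^-1 / 2 * c * enorm (g - gradient F x) ^+ 2.
Proof.
move=> L0 dF sF; set eta := (L * c)^-1; set y := x - _; set u := P^T *m g.
have eta0 : 0 < eta by rewrite invr_gt0 mulr_gt0.
have yx : y - x = (- eta) *: (P *m u) by rewrite /y addrAC subrr add0r -scaleNr -mulmxA.
apply: le_trans (smooth_descent x y dF sF) _; rewrite yx.
rewrite !(dotZl, dotZr) (dotC (gradient F x)) 2!dot_mulmx mulmxA PP mul_scalar_mx dotZr.
have le : enorm (u - P^T *m gradient F x) ^+ 2 <= c * enorm (g - gradient F x) ^+ 2.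
  by rewrite -mulmxBr; exact: enorm_trmx_frame_le.
have e2 : L * (eta * c) = 1.
  by rewrite mulrCA mulVf// gt_eqF// mulr_gt0.
move: le; rewrite -(ler_pM2l eta0).
rewrite !enorm_sqr !(dotDl, dotDr, dotNl, dotNr) (dotC (P^T *m _) u) => le.
have -> : L / 2 * (- eta * (- eta * (c * dot u u))) = eta / 2 * dot u u.
  transitivity (L * (eta * c) * (eta / 2) * dot u u); last by rewrite e2 mul1r.
  by field.
lra.
Qed.

End descent.
(** * Exponential moments and Haar matrices *)

Section exponential_moments.
Context {R : realType} d (T : measurableType d) (nu : probability T R).
Local Open Scope ereal_scope.

(** Pointwise, [exp(-t 1_A) + (1 - exp(-t)) 1_A = 1]; it remains to use [1 - y <= exp(-y)]. *)
Lemma integral_expR_indic_le (A : set T) (p t : R) : measurable A -> (0 <= t)%R ->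
  p%:E <= nu A ->
  \int[nu]_x (expR (- t * \1_A x))%:E <= (expR (- (p * (1 - expR (- t)))))%:E.
Proof.
move=> mA t0 pA; set c : R := (1 - expR (- t))%R.
have c0 : (0 <= c)%R by rewrite subr_ge0 expR_le1 oppr_le0.
have mexp : measurable_fun setT (fun x => (expR (- t * \1_A x))%:E).
  apply/measurable_EFinP; apply: measurableT_comp => //.
  by apply: measurable_funM => //; exact: measurable_indic.
have mind : measurable_fun setT (fun x => (\1_A x)%:E : \bar R).
  by apply/measurable_EFinP; exact: measurable_indic.
have : \int[nu]_x ((expR (- t * \1_A x))%:E + c%:E * (\1_A x)%:E) = 1.
  transitivity (\int[nu]_x (cst 1 x : \bar R)).
    apply: eq_integral => x _; rewrite -EFinM -EFinD indicE /c.
    by case: (x \in A) => /=; congr EFin; rewrite ?mulr1 ?mulr0 ?expR0; ring.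
  by rewrite integral_cst// mul1e; exact: probability_setT.
rewrite ge0_integralD//; [|by move=> x _; rewrite -EFinM lee_fin mulr_ge0|exact: measurable_funeM].
rewrite ge0_integralZl// integral_indic// setIT => e.
set I := \int[nu]_x _ in e *.
have nuA : nu A \is a fin_num by exact: fin_num_measure.
have -> : I = (1 - c * fine (nu A))%:E.
  by rewrite EFinB EFinM fineK// -[X in X - _]e addeK// fin_numM.
rewrite lee_fin; apply: le_trans (expR_ge1Dx _).
by rewrite lerD2l lerN2 mulrC ler_wpM2l// -lee_fin fineK.
Qed.

Lemma exp_markov (h : T -> R) (c l : R) : measurable_fun setT h ->
  \int[nu]_x (expR (h x))%:E <= (expR c)%:E ->
  nu [set x | (c + l < h x)%R] <= (expR (- l))%:E.
Proof.
move=> mh hc; set A := [set x | _].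
have mA : measurable A.
  by rewrite /A -[X in measurable X]setTI -preimage_itvoy; apply: mh => //; exact: measurable_itv.
have mexp : measurable_fun setT (fun x => (expR (h x))%:E).
  by apply/measurable_EFinP; exact: measurableT_comp.
have : (expR (c + l))%:E * nu A <= (expR c)%:E.
  rewrite -integral_cst//; apply: le_trans hc.
  apply: (@le_trans _ _ (\int[nu]_(x in A) (expR (h x))%:E)).
    apply: ge0_le_integral => //.
    - by move=> x _; rewrite lee_fin expR_ge0.
    - exact: measurable_funTS.
    by move=> x Ax; rewrite lee_fin ler_expR ltW.
  by apply: ge0_subset_integral.
rewrite -(fineK (fin_num_measure nu _ mA)) -EFinM !lee_fin.
rewrite expRD -mulrA -ler_pdivlMl ?expR_gt0// mulVf ?gt_eqF ?expR_gt0// => nuA.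
by rewrite expRN -[leRHS]mulr1 ler_pdivlMl ?expR_gt0.
Qed.

End exponential_moments.

(** Turns the factor [1 - exp(-t)] of the Chernoff bound into [t - t^2 / 2], from which the square
    root of the final denominator arises. *)
Lemma expRN_le_quadratic (R : realType) (t : R) : 0 <= t -> expR (- t) <= 1 - t + t ^+ 2 / 2.
Proof.
move=> t0; pose g (s : R) : R := 1 - s + s ^+ 2 / 2 - expR (- s).
pose g' (s : R) : R := - 1 + s + expR (- s).
have dg : forall s : R, is_derive s (1 : R) g (g' s).
  move=> s; rewrite /g /g'.
  have h1 : is_derive s (1 : R) (fun s : R => expR (- s)) (- expR (- s)).
    have hN : is_derive s (1 : R) (fun s : R => - s) (- 1) by apply: is_derive_eq.
    have := is_derive1_comp (f := @expR R) (g := fun s : R => - s) (x := s).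
    by move=> /(_ _ _ (is_derive_expR _) hN); rewrite mulrN1.
  by apply: is_derive_eq; rewrite /GRing.scale /=; field.
have [|s] := @MVT_segment R g g' 0 t t0 (fun s _ => dg s).
  by apply: derivable_within_continuous => s _; have [] := dg s.
rewrite in_itv/= => /andP[s0 _].
have := expR_ge1Dx (- s); rewrite /g /g' oppr0 expR0 => h.
have : 0 <= (- 1 + s + expR (- s)) * (t - 0) by rewrite mulr_ge0//; lra.
lra.
Qed.

(** Unbiasedness writes each partial derivative of [F] as an integral of a jointly measurable
    function; Tonelli is applied to its positive and negative parts. *)
Lemma measurable_gradient (R : realType) d2 (Xi : measurableType d2) (D : probability Xi R)
    (n : nat) (f : 'cV[R]_n -> Xi -> R) (F : 'cV[R]_n -> R) :
  measurable_fun [set: 'cV[R]_n * Xi] (fun p => sgrad f p.1 p.2) -> unbiased D f F ->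
  measurable_fun setT (gradient F).
Proof.
move=> mf uf; apply: measurable_fun_mx => // i j; rewrite ord1 {j}.
pose phi (p : 'cV[R]_n * Xi) := (sgrad f p.1 p.2 i 0)%:E.
have mphi : measurable_fun setT phi.
  by apply/measurable_EFinP; exact: measurable_fun_entry.
apply/measurable_EFinP.
have -> : EFin \o (fun x => gradient F x i 0) = fun x => (\int[D]_z phi (x, z))%E.
  by apply/funext => x; have [_ h] := uf x i; rewrite /= -h unlock.
have -> : (fun x => (\int[D]_z phi (x, z))%E) =
    (fun x => (fubini_F D phi^\+%E x - fubini_F D phi^\-%E x)%E).
  apply/funext => x; rewrite integralE /fubini_F.
  by congr (_ - _)%E; apply: eq_integral => z _; rewrite ?funeposE ?funenegE.
by apply: emeasurable_funB; apply: measurable_fun_fubini_tonelli_F => //;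
  [exact: measurable_funepos|exact: measurable_funeneg].
Qed.

Section aligned.
Context {R : realType} (d r : nat).

Definition aligned (v : 'cV[R]_d) : set 'M[R]_(d, r) :=
  [set M | 2^-1 * enorm v ^+ 2 <= enorm (M^T *m v) ^+ 2].

Lemma measurable_aligned_set (v : 'cV[R]_d) : measurable (aligned v).
Proof.
have mf : measurable_fun setT (fun M : 'M[R]_(d, r) => enorm (M^T *m v) ^+ 2).
  by apply: measurable_enorm_sqr; apply: measurable_mulmx => //; apply: measurable_trmx.
rewrite /aligned -[X in measurable X]setTI -preimage_itvcy.
by apply: mf => //; exact: measurable_itv.
Qed.

(** Joint in the vector and the matrix, since alignment is tested against the random gradient of an
    iterate. *)
Lemma measurable_aligned d' (S : measurableType d') (v : S -> 'cV[R]_d) (M : S -> 'M[R]_(d, r)) :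
  measurable_fun setT v -> measurable_fun setT M ->
  measurable_fun setT (fun s => \1_(aligned (v s)) (M s) : R).
Proof.
move=> mv mM.
have -> : (fun s => \1_(aligned (v s)) (M s) : R) =
    (fun s => if 2^-1 * enorm (v s) ^+ 2 <= enorm ((M s)^T *m v s) ^+ 2 then 1 else 0).
  apply/funext => s; rewrite indicE; case: ifPn => h; first by rewrite mem_set.
  by rewrite memNset//; exact/negP.
apply: measurable_fun_ifT => //; apply: measurable_fun_ler.
  by apply: measurable_funM => //; exact: measurable_enorm_sqr.
by apply: measurable_enorm_sqr; apply: measurable_mulmx => //; apply: measurable_trmx.
Qed.

End aligned.

Section haar_matrix.
Context {R : realType} d1 (Omega : measurableType d1) (Pr : probability Omega R).
Context (d r : nat) (r_gt0 : (0 < r)%N) (le_rd : (r <= d)%N).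
Variable X : {RV Pr >-> 'M[R]_(d, r)}.
Hypothesis haarX : is_haar_matrix le_rd X.
Let c : R := d%:R / r%:R.

Let c0 : 0 < c.
Proof. by rewrite divr_gt0 ?ltr0n// (leq_trans r_gt0). Qed.

Let scaled_frame (Q : 'M[R]_d) : orthogonal_group Q ->
  (scaled_first_cols le_rd Q)^T *m scaled_first_cols le_rd Q = c%:M.
Proof.
move=> OQ; rewrite /scaled_first_cols [(_ *: _)^T]linearZ/= -scalemxAl -scalemxAr scalerA -expr2.
rewrite orthogonal_first_cols//.
by rewrite sqr_sqrtr ?ltW// scale_scalar_mx mulr1.
Qed.

Let mscaled : measurable_fun setT (scaled_first_cols le_rd : 'M[R]_d -> 'M[R]_(d, r)).
Proof.
apply: measurable_scalemx => //; apply: measurable_fun_mx => // i j.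
by under eq_fun do rewrite mxE; exact: measurable_mx_entry.
Qed.

Let mpre (A : set 'M[R]_(d, r)) : measurable A -> measurable (scaled_first_cols le_rd @^-1` A).
Proof. by move=> mA; rewrite -[X in measurable X]setTI; exact: mscaled. Qed.

Lemma haar_matrix_frame : Pr (X @^-1` [set M | M^T *m M = c%:M]) = 1%E.
Proof.
have [nu haar Xnu] := haarX.
apply/eqP; rewrite eq_le probability_le1/=; last first.
  by rewrite -[X in measurable X]setTI; apply: measurable_funPT => //; exact: measurable_frame_set.
have -> : Pr (X @^-1` [set M | M^T *m M = c%:M]) =
  nu (scaled_first_cols le_rd @^-1` [set M | M^T *m M = c%:M]).
  by apply: Xnu; exact: measurable_frame_set.
apply: (@le_trans _ _ (nu (@orthogonal_group R d))).
  exact: (eq_ind_r (fun x => 1%:E <= x)%E (lexx _) haar.1).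
apply: le_measure; rewrite ?inE; [exact: measurable_orthogonal_group| |].
  by apply: mpre; exact: measurable_frame_set.
by move=> Q OQ; exact: scaled_frame.
Qed.

(** The threshold [r / (2 d)] of [haar_proj_tail] times the squared scaling [d / r] is the 1/2 of
    [aligned]. *)
Lemma haar_matrix_tail (v : 'cV[R]_d) :
  ((mu_const d r)%:E <= distribution Pr X (aligned v))%E.
Proof.
have [nu haar Xnu] := haarX; have d0 : (0 < d)%N := leq_trans r_gt0 le_rd.
rewrite Xnu; last exact: measurable_aligned_set.
apply: le_trans (haar_proj_tail le_rd haar v r_gt0) _.
apply: le_measure; rewrite ?inE.
- by apply: measurableI; [exact: measurable_orthogonal_group|exact: measurable_proj_ge].
- by apply: mpre; exact: measurable_aligned_set.
move=> Q [OQ /= h]; rewrite /aligned /= /scaled_first_cols [(_ *: _)^T]linearZ/= -scalemxAl enormZ exprMn.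
rewrite !enorm_sqr real_normK ?num_real// sqr_sqrtr; last exact: ltW c0.
have := ler_wpM2l (ltW c0) h; apply: le_trans.
rewrite mulrA ler_wpM2r ?dot_ge0// /c.
have -> : d%:R / r%:R * (r%:R / (2 * d%:R)) = 2^-1 :> R; last by [].
by field; rewrite !pnatr_eq0 -!lt0n d0 r_gt0.
Qed.

End haar_matrix.

(** * The stochastic process *)

Section rs_sgd_process.
Context {R : realType} d1 (Omega : measurableType d1) (Pr : probability Omega R).
Context d2 (Xi : measurableType d2) (D : probability Xi R) (d r b : nat).
Variables (r_gt0 : (0 < r)%N) (le_rd : (r <= d)%N).
Variables (f : 'cV[R]_d -> Xi -> R) (F : 'cV[R]_d -> R).
Hypothesis f_meas : measurable_fun [set: 'cV[R]_d * Xi] (fun p => sgrad f p.1 p.2).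
Hypothesis f_unbiased : unbiased D f F.
Variables (P : nat -> {RV Pr >-> 'M[R]_(d, r)}) (xi : nat -> 'I_b -> {RV Pr >-> Xi}).
Hypothesis draws : rs_sgd_draws D le_rd P xi.
Variables (eta : R) (x0 : 'cV[R]_d).

Local Notation index := (nat + nat * 'I_b)%type.
Local Notation x := (rs_sgd f eta x0 (fun k => P k) (fun k j => xi k j)).
Local Notation sigma := (rs_sgd_sigma (fun k => P k : Omega -> _) (fun k j => xi k j : Omega -> _)).

(* The frame [P k] is in the past of no sample of iteration [k], and conversely no such sample is
   in the past used for [P k], which is [past_index k 0]. *)
Definition past_index (k j : nat) : set index :=
  [set i : index | match i with
           | inl l => (l < k)%N
           | inr (l, i) => (l < k)%N || ((l == k) && (i < j)%N)
           end].

Definition past k j : set (set Omega) := \bigcup_(i in past_index k j) sigma i.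

Let sigma_measurable i : sigma i `<=` measurable.
Proof.
by case: i => [k|[k j]] _ [B mB <-] /=; exact: measurable_funPT.
Qed.

Let sigma_setI i : setI_closed (sigma i).
Proof.
case: i => [k|[k j]] _ _ [A mA <-] [B mB <-]; exists (A `&` B); rewrite ?setTI//;
exact: measurableI.
Qed.

Lemma past_measurable k j : past k j `<=` measurable.
Proof. by move=> A [i _ sA]; exact: sigma_measurable sA. Qed.

Let past_indep k j i A B : ~ past_index k j i -> <<s past k j >> A -> sigma i B ->
  Pr (A `&` B) = (Pr A * Pr B)%E.
Proof.
have [_ _ ind] := draws; move=> ni sA sB.
exact: (past_independent sigma_measurable sigma_setI ind ni sA sB).
Qed.

Lemma integral_past_frame k (h : g_sigma_algebraType (past k 0) * 'M[R]_(d, r) -> \bar R) :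
  measurable_fun setT h -> (forall p, 0 <= h p)%E ->
  (\int[Pr]_w h (w, P k w) = \int[Pr]_w \int[distribution Pr (P k)]_M h (w, M))%E.
Proof.
move=> mh h0; apply: integral_past => //; first exact: past_measurable.
move=> A B sA mB; apply: (@past_indep k 0 (inl k)) => //.
  by rewrite /past_index /= ltnn.
by exists B; rewrite ?setTI.
Qed.

Lemma integral_past_sample k (j : 'I_b) (h : g_sigma_algebraType (past k j) * Xi -> \bar R) :
  measurable_fun setT h -> (forall p, 0 <= h p)%E ->
  (\int[Pr]_w h (w, xi k j w) = \int[Pr]_w \int[distribution Pr (xi k j)]_z h (w, z))%E.
Proof.
move=> mh h0; apply: integral_past => //; first exact: past_measurable.
move=> A B sA mB; apply: (@past_indep k j (inr (k, j))) => //.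
  by rewrite /past_index /= ltnn eqxx ltnn.
by exists B; rewrite ?setTI.
Qed.

Section adapted.
Variables (k j : nat).
Let S := g_sigma_algebraType (past k j).

Lemma past_frame l : (l < k)%N -> measurable_fun [set: S] (P l : S -> 'M[R]_(d, r)).
Proof.
move=> lk _ B mB; apply: sub_sigma_algebra; exists (inl l) => //.
by exists B.
Qed.

Lemma past_sample l (i : 'I_b) : (l < k)%N || ((l == k) && (i < j)%N) ->
  measurable_fun [set: S] (xi l i : S -> Xi).
Proof.
move=> lk _ B mB; apply: sub_sigma_algebra; exists (inr (l, i)) => //.
by exists B.
Qed.

Let past_minibatch l (y : S -> 'cV[R]_d) : (l < k)%N -> measurable_fun [set: S] y ->
  measurable_fun [set: S] (fun w => minibatch_grad f (y w) (fun i => xi l i w)).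
Proof.
move=> lk my; apply: measurable_scalemx => //; apply: measurable_fun_mx => // i m.
under eq_fun do rewrite summxE.
apply: measurable_sum => u; apply: measurable_fun_entry.
apply: (measurableT_comp f_meas (f := _) (g := fun w : S => (y w, xi l u w))).
by apply/measurable_fun_pair => //; apply: past_sample; rewrite lk.
Qed.

Lemma past_rs_sgd l : (l <= k)%N -> measurable_fun [set: S] (x l : S -> 'cV[R]_d).
Proof.
elim: l => [|l IH] lk; first exact: measurable_cst.
have ml := IH (ltnW lk).
rewrite /=; apply: measurable_submx => //; apply: measurable_scalemx => //.
apply: measurable_mulmx => //; last exact: past_minibatch.
have mP := past_frame lk.
by apply: measurable_mulmx => //; apply: measurable_trmx.
Qed.

Let mgF := measurable_gradient f_meas f_unbiased.

Lemma past_gradient l : (l <= k)%N ->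
  measurable_fun [set: S] (fun w : S => gradient F (x l w)).
Proof. by move=> lk; exact: (measurableT_comp mgF (past_rs_sgd lk)). Qed.

End adapted.

Definition sample_noise k i w : 'cV[R]_d := sgrad f (x k w) (xi k i w) - gradient F (x k w).

(** The bound [j] is a natural number, so that [j = b] gives the whole minibatch. The sum is not
    divided by [b] until the final theorem. *)
Definition noise_sum k j w : 'cV[R]_d := \sum_(i < b | (i < j)%N) sample_noise k i w.

Definition noise_energy k w : R := \sum_(l < k) dot (noise_sum l b w) (noise_sum l b w).

Definition aligned_steps k w : R := \sum_(l < k) \1_(aligned (gradient F (x l w))) (P l w).

Lemma measurable_of_past k j d' (U : measurableType d') (h : Omega -> U) :
  measurable_fun [set: g_sigma_algebraType (past k j)] (h : g_sigma_algebraType (past k j) -> U) ->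
  measurable_fun [set: Omega] h.
Proof.
move=> mh _ B mB; have := mh measurableT B mB; rewrite !setTI.
apply: smallest_sub; [exact: sigma_algebra_measurable|exact: past_measurable].
Qed.

Section adapted_noise.
Variables (k j : nat).
Let S := g_sigma_algebraType (past k j).

Lemma past_sample_noise l (i : 'I_b) : (l < k)%N || ((l == k) && (i < j)%N) ->
  measurable_fun [set: S] (sample_noise l i : S -> 'cV[R]_d).
Proof.
move=> lk; have lk' : (l <= k)%N by case/orP: lk => [/ltnW//|/andP[/eqP->]].
apply: measurable_submx => //; last exact: past_gradient.
apply: (measurableT_comp f_meas (f := _) (g := fun w : S => (x l w, xi l i w))).
by apply/measurable_fun_pair; [exact: past_rs_sgd|exact: past_sample].
Qed.

Lemma past_noise_sum l m : (l < k)%N || ((l == k) && (m <= j)%N) ->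
  measurable_fun [set: S] (noise_sum l m : S -> 'cV[R]_d).
Proof.
move=> lk; apply: measurable_fun_mx => // i u; rewrite /noise_sum.
under eq_fun do rewrite summxE big_mkcond /=.
apply: measurable_sum => q; case: (ltnP q m) => qm; last exact: measurable_cst.
apply: measurable_fun_entry; apply: past_sample_noise.
by case/orP: lk => [->//|/andP[-> mj]]; rewrite (leq_trans qm mj) orbT.
Qed.

Lemma past_noise_energy l : (l <= k)%N -> measurable_fun [set: S] (noise_energy l : S -> R).
Proof.
move=> lk; apply: measurable_sum => i.
have ik : (i < k)%N by exact: leq_trans lk.
by apply: measurable_dot; apply: past_noise_sum; rewrite ik.
Qed.

End adapted_noise.

Lemma past_aligned_steps k j l : (l <= k)%N ->
  measurable_fun [set: g_sigma_algebraType (past k j)]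
    (aligned_steps l : g_sigma_algebraType (past k j) -> R).
Proof.
move=> lk; apply: measurable_sum => i.
have ik : (i < k)%N by exact: leq_trans lk.
by apply: measurable_aligned; [apply: past_gradient; exact: ltnW|exact: past_frame].
Qed.

Let mu : R := mu_const d r.

(** Given the past, the gradient at [x k] is a fixed vector and [P k] is fresh, so
    [haar_matrix_tail] applies whatever that vector is. Each iteration thus costs the same
    factor. *)
Lemma aligned_steps_mgf (t : R) k : 0 <= t ->
  (\int[Pr]_w (expR (- t * aligned_steps k w))%:E <=
   (expR (- (k%:R * (mu * (1 - expR (- t))))))%:E)%E.
Proof.
move=> t0; elim: k => [|k IH].
  under eq_integral do rewrite /aligned_steps big_ord0 mulr0.
  by rewrite expR0 integral_cst// mul1e mul0r oppr0 expR0; exact: probability_le1.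
pose S := g_sigma_algebraType (past k 0).
pose h (p : S * 'M[R]_(d, r)) : \bar R := (expR (- t * (aligned_steps k p.1 +
  \1_(aligned (gradient F (x k p.1))) p.2)))%:E.
have mG1 : measurable_fun setT (fun p : S * 'M[R]_(d, r) => gradient F (x k p.1)).
  by apply: (measurableT_comp (@past_gradient k 0 k (leqnn k))); exact: measurable_fst.
have mh : measurable_fun setT h.
  apply/measurable_EFinP; apply: measurableT_comp => //; apply: measurable_funM => //.
  apply: measurable_funD; last by apply: measurable_aligned => //; exact: measurable_snd.
  by apply: (measurableT_comp (@past_aligned_steps k 0 k (leqnn k))); exact: measurable_fst.
have mS : measurable_fun setT (fun w => (expR (- t * aligned_steps k w))%:E).
  apply/measurable_EFinP; apply: measurableT_comp => //; apply: measurable_funM => //.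
  by apply: (@measurable_of_past k 0); exact: past_aligned_steps.
have -> : (\int[Pr]_w (expR (- t * aligned_steps k.+1 w))%:E = \int[Pr]_w h (w, P k w))%E.
  by apply: eq_integral => w _; rewrite /h /aligned_steps big_ord_recr.
rewrite integral_past_frame//; last by move=> p; rewrite lee_fin expR_ge0.
set q := expR (- (mu * (1 - expR (- t)))).
apply: (@le_trans _ _ (\int[Pr]_w (q%:E * (expR (- t * aligned_steps k w))%:E))%E); last first.
  rewrite ge0_integralZl//; last by rewrite lee_fin expR_ge0.
  apply: (@le_trans _ _ (q%:E * (expR (- (k%:R * (mu * (1 - expR (- t))))))%:E)%E).
    by rewrite lee_pmul2l// ?lte_fin ?expR_gt0.
  by rewrite -EFinM -expRD lee_fin ler_expR -natr1; lra.
apply: ge0_le_integral => //.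
- by move=> w _; apply: integral_ge0 => M _; rewrite lee_fin expR_ge0.
- apply: (@measurable_of_past k 0).
  have h0 p : (0 <= h p)%E by rewrite lee_fin expR_ge0.
  exact: (measurable_fun_fubini_tonelli_F (m2 := distribution Pr (P k)) _ mh h0).
- exact: measurable_funeM.
move=> w _.
have mA := @measurable_aligned_set R d r (gradient F (x k w)).
rewrite /h /=; under eq_integral do rewrite mulrDr expRD EFinM.
rewrite ge0_integralZl//; last first.
  by apply/measurable_EFinP; apply: measurableT_comp => //; apply: measurable_funM.
rewrite muleC lee_wpmul2r ?lee_fin ?expR_ge0//.
by apply: integral_expR_indic_le => //; have [haarP _ _] := draws; exact: haar_matrix_tail.
Qed.

Variable sig : R.
Hypotheses (sig_gt0 : 0 < sig) (f_subg : sub_gaussian D sig f F).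

Lemma sample_noise_mgf (y v : 'cV[R]_d) (K : R) : 1 <= K ->
  (\int[D]_z (expR (dot (v + (sgrad f y z - gradient F y)) (v + (sgrad f y z - gradient F y)) /
     (sig ^+ 2 * (K + 16))))%:E <= (expR (dot v v / (sig ^+ 2 * K) + K^-1))%:E)%E.
Proof.
move=> K1.
have mg : measurable_fun setT (fun z => sgrad f y z).
  apply: (measurableT_comp f_meas (f := _) (g := fun z => (y, z))).
  exact: measurable_fun_pair.
apply: (exp_sqr_norm_le (g := fun z => sgrad f y z - gradient F y)) => //.
- by apply: measurable_submx => //; exact: measurable_cst.
- by rewrite exprn_gt0.
- move=> i; have [int E] := f_unbiased y i.
  have e z : ((sgrad f y z - gradient F y) i 0)%:E = ((sgrad f y z i 0)%:E - (gradient F y i 0)%:E)%E.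
    by rewrite !mxE EFinB.
  have intc : D.-integrable setT (EFin \o cst (gradient F y i 0)).
    exact: finite_measure_integrable_cst.
  split; first by under eq_fun do rewrite e; exact: integrableB.
  under eq_integral do rewrite e; rewrite integralB//.
  rewrite unlock in E; rewrite E integral_cst//.
  by rewrite [X in (_ * X)%E](_ : _ = 1%E) ?mule1 ?subee//; exact: probability_setT.
- move=> c c0 cs.
  (* [lambda = sqrt c] converts the assumption on [lambda^2] into one that is linear in [c]. *)
  have lam : `|Num.sqrt c| <= 1 / sig.
    rewrite ger0_norm ?sqrtr_ge0// ler_pdivlMr//.
    by rewrite -(expr_le1 (n := 2))// ?mulr_ge0 ?sqrtr_ge0 ?(ltW sig_gt0)// exprMn sqr_sqrtr.
  have := f_subg y lam; rewrite unlock sqr_sqrtr//; apply: le_trans.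
  by under eq_integral do rewrite -enorm_sqr.
Qed.

Section noise_chain.
Variable K : R.
Hypotheses (K_ge1 : 1 <= K) (b_le_K : b%:R <= K).
Let C : R := sig ^+ 2 * (K + 16 * b%:R).

(* The variance proxy of the current minibatch grows with [j] while [b <= K] keeps the total cost
   [b / K] of an iteration below 1; after [b] samples it is [C], that of the completed ones. *)
Let noise_potential k j w : R :=
  noise_energy k w / C + dot (noise_sum k j w) (noise_sum k j w) / (sig ^+ 2 * (K + 16 * j%:R)).

Let noise_potential0 k w : noise_potential k 0 w = noise_energy k w / C.
Proof.
rewrite /noise_potential (_ : noise_sum k 0 w = 0); last by rewrite /noise_sum big_pred0.
by rewrite /dot big1 ?mul0r ?addr0// => i _; rewrite mxE mul0r.
Qed.

Let noise_potential_last k w : noise_potential k b w = noise_energy k.+1 w / C.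
Proof. by rewrite /noise_potential /noise_energy big_ord_recr/= [in RHS]mulrDl. Qed.

Let noise_sumS k (j : 'I_b) w : noise_sum k j.+1 w = noise_sum k j w + sample_noise k j w.
Proof.
rewrite /noise_sum (bigD1 j)//= addrC; congr (_ + _); apply: eq_bigl => i.
by rewrite ltnS ltn_neqAle andbC.
Qed.

Let noise_step k (j : 'I_b) :
  (\int[Pr]_w (expR (noise_potential k j.+1 w))%:E <=
   (expR K^-1)%:E * \int[Pr]_w (expR (noise_potential k j w))%:E)%E.
Proof.
pose S := g_sigma_algebraType (past k j).
(* The proxy before sample [j], which the sample raises to [Kj + 16]. Its cost [Kj^-1] is at most
   [K^-1], uniformly in [j]. *)
pose Kj : R := K + 16 * j%:R.
have Kj1 : 1 <= Kj by rewrite (le_trans K_ge1)// lerDl mulr_ge0.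
have KjS : K + 16 * j.+1%:R = Kj + 16 by rewrite /Kj -natr1; ring.
pose y (s : S) : 'cV[R]_d := x k s.
pose v (s : S) : 'cV[R]_d := noise_sum k j s.
pose e (s : S) : R := noise_energy k s.
pose n (p : S * Xi) : 'cV[R]_d := v p.1 + (sgrad f (y p.1) p.2 - gradient F (y p.1)).
pose h (p : S * Xi) : \bar R :=
  ((expR (e p.1 / C))%:E * (expR (dot (n p) (n p) / (sig ^+ 2 * (Kj + 16))))%:E)%E.
have my : measurable_fun setT y by exact: past_rs_sgd.
have mv : measurable_fun setT v by apply: past_noise_sum; rewrite eqxx leqnn orbT.
have me : measurable_fun setT e by exact: past_noise_energy.
have mn : measurable_fun setT n.
  apply: measurable_addmx => //; first exact: (measurableT_comp mv measurable_fst).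
  apply: measurable_submx => //; last first.
    exact: (measurableT_comp (past_gradient (leqnn k)) measurable_fst).
  apply: (measurableT_comp f_meas (f := _) (g := fun p : S * Xi => (y p.1, p.2))).
  apply: measurable_fun_pair; last exact: measurable_snd.
  exact: (measurableT_comp my measurable_fst).
have mexp d' (U : measurableType d') (g : U -> R) (c : R) : measurable_fun setT g ->
    measurable_fun setT (fun u => (expR (g u / c))%:E).
  by move=> mg; apply/measurable_EFinP; apply: measurableT_comp => //; exact: measurable_funM.
have mh : measurable_fun setT h.
  apply: emeasurable_funM.
    by apply: (mexp _ _ (fun p => e p.1)); exact: (measurableT_comp me measurable_fst).
  by apply: mexp; exact: measurable_dot.
have h0 p : (0 <= h p)%E by rewrite mule_ge0// lee_fin expR_ge0.
have mpot : measurable_fun setT (fun w => (expR (noise_potential k j w))%:E).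
  apply: (@measurable_of_past k j); apply/measurable_EFinP; apply: measurableT_comp => //.
  by apply: measurable_funD; apply: measurable_funM => //; exact: measurable_dot.
have -> : (\int[Pr]_w (expR (noise_potential k j.+1 w))%:E = \int[Pr]_w h (w, xi k j w))%E.
  by apply: eq_integral => w _; rewrite /noise_potential KjS expRD EFinM noise_sumS.
rewrite integral_past_sample//.
rewrite -ge0_integralZl//.
apply: ge0_le_integral => //.
- by move=> w _; exact: integral_ge0.
- apply: (@measurable_of_past k j).
  exact: (measurable_fun_fubini_tonelli_F (m2 := distribution Pr (xi k j)) _ mh h0).
- exact: measurable_funeM.
move=> w _; rewrite /h /= ge0_integralZl//; last first.
  by apply: (mexp _ _ (fun z => dot (n (w, z)) (n (w, z)))); apply: measurable_dot;
     exact: (measurable_fun_pair2 (f := n) _ mn).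
have -> : (\int[distribution Pr (xi k j)]_z (expR (dot (n (w, z)) (n (w, z)) / (sig ^+ 2 * (Kj + 16))))%:E =
   \int[D]_z (expR (dot (n (w, z)) (n (w, z)) / (sig ^+ 2 * (Kj + 16))))%:E)%E.
  have [_ law _] := draws.
  by apply: eq_measure_integral => A mA _; exact: law.
rewrite /noise_potential expRD EFinM muleCA lee_pmul2l// ?lte_fin ?expR_gt0//.
apply: (le_trans (sample_noise_mgf (y w) (v w) Kj1)).
have K0 : 0 < K := lt_le_trans ltr01 K_ge1.
have Kj0 : 0 < Kj := lt_le_trans ltr01 Kj1.
by rewrite -EFinM -expRD lee_fin ler_expR addrC lerD2r lef_pV2// lerDl mulr_ge0.
Qed.

(** The potential of iteration [k] at [j = b] is that of iteration [k.+1] at [j = 0], so the chains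
    of successive minibatches join end to end. *)
Lemma noise_energy_mgf k :
  (\int[Pr]_w (expR (noise_energy k w / C))%:E <= (expR k%:R)%:E)%E.
Proof.
elim: k => [|k IH].
  under eq_integral do rewrite /noise_energy big_ord0 mul0r.
  by rewrite expR0 integral_cst// mul1e; exact: probability_le1.
have chain j : (j <= b)%N ->
    (\int[Pr]_w (expR (noise_potential k j w))%:E <= (expR (j%:R / K + k%:R))%:E)%E.
  elim: j => [|j IHj] jb.
    by under eq_integral do rewrite noise_potential0; rewrite mul0r add0r.
  apply: le_trans (noise_step k (Ordinal jb)) _.
  apply: (@le_trans _ _ ((expR K^-1)%:E * (expR (j%:R / K + k%:R))%:E)%E).
    by rewrite lee_pmul2l// ?lte_fin ?expR_gt0//; exact/IHj/ltnW.
  by rewrite -EFinM -expRD lee_fin ler_expR -natr1 mulrDl mul1r; lra.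
have := chain b (leqnn b); under eq_integral do rewrite noise_potential_last.
move=> /le_trans; apply; rewrite lee_fin ler_expR -natr1 addrC lerD2l.
by rewrite ler_pdivrMr ?mul1r// (lt_le_trans _ K_ge1).
Qed.

End noise_chain.

End rs_sgd_process.

(** * Deterministic bound along one trajectory *)

Section pathwise.
Context {R : realType} (d r T : nat).
Variables (F : 'cV[R]_d -> R) (L c : R).
Hypotheses (dF : forall z, differentiable F z) (sF : smooth L F) (L0 : 0 < L) (c0 : 0 < c).
Hypothesis F_bounded : has_lbound (range F).
Variables (x g : nat -> 'cV[R]_d) (P : nat -> 'M[R]_(d, r)).
Hypothesis PP : forall k, (P k)^T *m P k = c%:M.
Hypothesis xS : forall k, x k.+1 = x k - (L * c)^-1 *: (P k *m (P k)^T *m g k).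

Let Delta0 : R := F (x 0%N) - inf (range F).

Lemma sum_projected_gradient_le :
  \sum_(k < T) enorm ((P k)^T *m gradient F (x k)) ^+ 2 <=
  2 * L * c * Delta0 + c * \sum_(k < T) enorm (g k - gradient F (x k)) ^+ 2.
Proof.
have Lc : 0 < L * c by exact: mulr_gt0.
suff H n : \sum_(k < n) enorm ((P k)^T *m gradient F (x k)) ^+ 2 <=
    2 * L * c * (F (x 0%N) - F (x n)) + c * \sum_(k < n) enorm (g k - gradient F (x k)) ^+ 2.
  apply: le_trans (H T) _; rewrite lerD2r ler_pM2l -?mulrA ?mulr_gt0// lerD2l lerN2.
  by apply: ge_inf => //; exists (x T).
elim: n => [|n IH]; first by rewrite !big_ord0 subrr !mulr0 addr0.
rewrite !big_ord_recr /=; have := subspace_descent c0 (PP n) (x n) (g n) L0 dF sF.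
rewrite -xS; set u := enorm (_ *m _) ^+ 2; set v := enorm (g n - _) ^+ 2 => step.
have {}step : u <= 2 * L * c * (F (x n) - F (x n.+1)) + c * v.
  rewrite -(ler_pM2l (_ : 0 < (L * c)^-1 / 2)) ?divr_gt0 ?invr_gt0//.
  have -> : (L * c)^-1 / 2 * (2 * L * c * (F (x n) - F (x n.+1)) + c * v) =
      F (x n) - F (x n.+1) + (L * c)^-1 / 2 * c * v.
    by field; rewrite !gt_eqF.
  lra.
apply: le_trans (lerD IH step) _; lra.
Qed.

(** An aligned iteration contributes at least [M / 2] to the sum of projected squared gradients, and
    any other at least 0. *)
Lemma min_gradient_le (Eb Den : R) :
  0 < Den -> Den <= \sum_(k < T) \1_(aligned (gradient F (x k))) (P k) ->
  \sum_(k < T) enorm (g k - gradient F (x k)) ^+ 2 <= Eb ->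
  \big[Num.min/enorm (gradient F (x 0%N)) ^+ 2]_(k < T) enorm (gradient F (x k)) ^+ 2 <=
  (4 * L * c * Delta0 + 2 * c * Eb) / Den.
Proof.
move=> Den0 DenS EbS; set M := \big[_/_]_(k < T) _.
have M0 : 0 <= M.
  by apply/bigmin_geP; split=> [|k _]; exact: sqr_ge0.
have step : 2^-1 * M * Den <= \sum_(k < T) enorm ((P k)^T *m gradient F (x k)) ^+ 2.
  apply: (@le_trans _ _ (2^-1 * M * \sum_(k < T) \1_(aligned (gradient F (x k))) (P k))).
    by rewrite ler_wpM2l// mulr_ge0.
  rewrite mulr_sumr; apply: ler_sum => k _; rewrite indicE.
  have [h|h] := boolP (_ \in _); last by rewrite mulr0 sqr_ge0.
  rewrite mulr1; move: h; rewrite inE /aligned/= => h; apply: le_trans h.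
  by rewrite ler_pM2l// bigmin_le.
rewrite ler_pdivlMr//.
have := sum_projected_gradient_le.
have : c * \sum_(k < T) enorm (g k - gradient F (x k)) ^+ 2 <= c * Eb by rewrite ler_pM2l.
lra.
Qed.

End pathwise.

(** * The bound in probability *)

Lemma measurable_bigmin (R : realType) d (S : measurableType d) n (f0 : S -> R)
    (f : 'I_n -> S -> R) : measurable_fun setT f0 -> (forall k, measurable_fun setT (f k)) ->
  measurable_fun setT (fun s => \big[Num.min/f0 s]_(k < n) f k s).
Proof.
elim: n f => [|n IH] f mf0 mf; first by under eq_fun do rewrite big_ord0.
by under eq_fun do rewrite big_ord_recl; apply: measurable_minr => //; exact: IH.
Qed.

Theorem theorem4p2 (R : realType)
  (d1 : measure_display) (Omega : measurableType d1) (Pr : probability Omega R)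
  (d2 : measure_display) (Xi : measurableType d2) (D : probability Xi R)
  (d r : nat) (r_ge1 : (1 <= r)%N) (le_rd : (r <= d)%N)
  (f : 'cV[R]_d -> Xi -> R) (F : 'cV[R]_d -> R)
  (f_diff : forall x z, differentiable (f ^~ z) x)
  (f_meas : measurable_fun [set: 'cV[R]_d * Xi] (fun p => sgrad f p.1 p.2))
  (F_def : is_objective D f F)
  (F_diff : forall x, differentiable F x)
  (F_bounded : has_lbound (range F))
  (L : R) (L_gt0 : 0 < L) (F_smooth : smooth L F)
  (f_unbiased : unbiased D f F)
  (sigma : R) (sigma_gt0 : 0 < sigma) (f_subg : sub_gaussian D sigma f F)
  (T : nat) (T_ge1 : (1 <= T)%N) (B q : R) (B_gt0 : 0 < B) (q_gt0 : 0 < q)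
  (P : nat -> {RV Pr >-> 'M[R]_(d, r)})
  (xi : nat -> 'I_(minibatch_size B q T) -> {RV Pr >-> Xi})
  (draws : rs_sgd_draws D le_rd P xi)
  (x0 : 'cV[R]_d) (delta : R) (delta_gt0 : 0 < delta) (delta_lt1 : delta < 1) :
  let Bbar : R := (minibatch_size B q T)%:R in
  let dr : R := d%:R / r%:R in
  let eta := r%:R / (L * d%:R) in
  let x := rs_sgd f eta x0 (fun k => P k) (fun k j => xi k j) in
  let Delta0 := F x0 - inf (range F) in
  let mu : R := mu_const d r in
  let noise := alpha ^+ 2 * sigma ^+ 2 / Bbar in
  let ell := ln (2 / delta) in
  2 * ell < mu * T%:R ->
  ((1 - delta)%R%:E <=
   Pr [set w |
     \big[Num.min/enorm (gradient F (x 0%N w)) ^+ 2]_(k < T)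
        enorm (gradient F (x k w)) ^+ 2
     <= 4 * L * dr * Delta0 / (mu * T%:R - Num.sqrt (2 * mu * T%:R * ell))
        + 2 * dr * noise * (d%:R * ln 5 + 1)
            / (mu - Num.sqrt (2 * (mu / T%:R) * ell))
        + 2 * dr * noise * ell
            / (mu * T%:R - Num.sqrt (2 * mu * T%:R * ell))]%R)%E.
Proof.
move=> Bbar dr eta x Delta0 mu noise ell h2.
set b := minibatch_size B q T.
have b0 : (0 < b)%N.
  by rewrite /b /minibatch_size absz_gt0 gt_eqF// ceil_gt0 lt_max ltr01.
have r0 : 0 < r%:R :> R by rewrite ltr0n.
have d0 : 0 < d%:R :> R by rewrite ltr0n (leq_trans r_ge1).
have dr0 : 0 < dr by exact: divr_gt0.
have T0 : 0 < T%:R :> R by rewrite ltr0n.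
have ell0 : 0 < ell by rewrite ln_gt0// ltr_pdivlMr//; lra.
set m := mu * T%:R.
have m0 : 0 < m by apply: lt_trans h2; exact: mulr_gt0.
have mu0 : 0 < mu by rewrite -(pmulr_lgt0 _ T0).
set a := Num.sqrt (2 * mu * T%:R * ell).
have a2 : a ^+ 2 = 2 * m * ell.
  by rewrite sqr_sqrtr /m; [ring|rewrite !mulr_ge0// ltW].
have a0 : 0 < a by rewrite sqrtr_gt0 !mulr_gt0.
have am : a < m.
  rewrite -(ltr_pXn2r (n := 2)) ?nnegrE ?(ltW a0) ?(ltW m0)// a2 expr2.
  by rewrite -mulrA mulrCA ltr_pM2l.
have expell : expR (- ell) = delta / 2.
  by rewrite expRN lnK ?invf_div// posrE divr_gt0.
have eta_dr : eta = (L * dr)^-1.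
  by rewrite /eta /dr; field; rewrite !gt_eqF.
have bR : 1 <= b%:R :> R by rewrite ler1n.
have alpha2 : 17 <= alpha ^+ 2 :> R.
  have e2 : 2 <= expR 1 :> R by exact: expR_ge1Dx.
  rewrite /alpha exprMn sqr_sqrtr; first nra.
  by rewrite mulr_ge0// mulr_ge0 ?addr_ge0 ?expR_ge0.
have alpha_neq0 : alpha != 0 :> R.
  by apply: contraTneq alpha2 => ->; rewrite expr0n -ltNge.
(* Chosen so that [C = alpha^2 sigma^2 b]; the estimate [17 <= alpha^2] is what makes [b <= K]. *)
pose K : R := (alpha ^+ 2 - 16) * b%:R.
have Kb : b%:R <= K by rewrite ler_peMl//; lra.
have K1 : 1 <= K := le_trans bR Kb.
(* Chernoff yields at least [m - m t / 2 - ell / t] aligned steps; this [t] equals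
   [sqrt (2 ell / m)], the maximiser, and the value there is [m - a]. *)
pose t := a / m.
have t0 : 0 < t by exact: divr_gt0.
pose C : R := sigma ^+ 2 * (K + 16 * b%:R).
have CE : C = alpha ^+ 2 * sigma ^+ 2 * b%:R by rewrite /C /K; ring.
pose steps := aligned_steps f F P xi eta x0 T.
pose energy := noise_energy f F P xi eta x0 T.
have msteps : measurable_fun setT steps.
  apply: (@measurable_of_past _ _ _ Pr _ _ d r b P xi T 0).
  exact: past_aligned_steps.
have menergy : measurable_fun setT energy.
  apply: (@measurable_of_past _ _ _ Pr _ _ d r b P xi T 0).
  exact: past_noise_energy.
have bad1 := exp_markov (nu := Pr) ell (measurable_funM (measurable_cst (- t)) msteps)
  (aligned_steps_mgf r_ge1 f_meas f_unbiased draws eta x0 T (ltW t0)).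
have bad2 := exp_markov (nu := Pr) ell (measurable_funM menergy (measurable_cst C^-1))
  (noise_energy_mgf f_meas f_unbiased draws eta x0 sigma_gt0 f_subg K1 Kb T).
(* The frame identity holds only almost surely for each [k], while the pathwise argument uses it for
   all [k] at once; the countable union of the exceptions is null. *)
pose bad_frame k : set Omega := ~` (P k @^-1` [set M | M^T *m M = dr%:M]).
have mframe k : measurable (P k @^-1` [set M | M^T *m M = dr%:M]).
  rewrite -[X in measurable X]setTI; apply: measurable_funPT => //.
  exact: measurable_frame_set.
have mbadf : measurable (\bigcup_k bad_frame k).
  by apply: bigcup_measurable => k _; exact: measurableC.
have bad3 : Pr (\bigcup_k bad_frame k) = 0%E.
  apply/negligibleP => //; apply: negligible_bigcup => k.
  apply/negligibleP; first exact: measurableC.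
  have := probability_setC Pr (mframe k); have [haarP _ _] := draws.
  by rewrite (haar_matrix_frame r_ge1 (haarP k)) subee.
set bad1S := [set w | _] in bad1; set bad2S := [set w | _] in bad2.
have mbad1 : measurable bad1S.
  rewrite /bad1S -[X in measurable X]setTI -preimage_itvoy.
  by apply: measurable_funM => //; exact: measurable_itv.
have mbad2 : measurable bad2S.
  rewrite /bad2S -[X in measurable X]setTI -preimage_itvoy.
  by apply: measurable_funM => //; exact: measurable_itv.
set bound := (X in [set w | _ <= X]).
set good := [set w | _].
have mx k : measurable_fun setT (x k).
  apply: (@measurable_of_past _ _ _ Pr _ _ d r b P xi k 0).
  exact: past_rs_sgd.
have mgrad k : measurable_fun setT (fun w => enorm (gradient F (x k w)) ^+ 2).
  apply: measurable_enorm_sqr.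
  exact: (measurableT_comp (measurable_gradient f_meas f_unbiased) (mx k)).
have mgood : measurable good.
  rewrite /good -[X in measurable X]setTI -preimage_itvNyc.
  by apply: measurable_bigmin => //; exact: measurable_itv.
have incl : ~` good `<=` bad1S `|` bad2S `|` \bigcup_k bad_frame k.
  apply: subsetCl; rewrite !setCU => w [[nbad1 nbad2] nbadf].
  have PP k : (P k w)^T *m P k w = dr%:M.
    by apply: contrapT => h; apply: nbadf; exists k.
  have steps_ge : m - a <= steps w.
    move/negP: nbad1; rewrite -leNgt => h1.
    have tm : m * t = a by rewrite /t mulrCA divff ?mulr1// gt_eqF.
    have ta : t * a = 2 * ell by rewrite /t mulrAC -expr2 a2 mulrAC mulfK// gt_eqF.
    have := expRN_le_quadratic (ltW t0); rewrite -(ler_pM2l m0).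
    have -> : m * (1 - t + t ^+ 2 / 2) = m - m * t + (t * (m * t)) / 2 by ring.
    rewrite tm ta => h3; rewrite -(ler_pM2l t0) mulrBr mulrC tm ta; move: h1.
    have -> : T%:R * (mu_const d r * (1 - expR (- t))) = m - m * expR (- t).
      by rewrite /m /mu; ring.
    rewrite /= => h1; lra.
  have energy_le : energy w / C <= T%:R + ell.
    by move/negP: nbad2; rewrite -leNgt.
  pose g k := minibatch_grad f (x k w) (fun j => xi k j w).
  have gE k : g k - gradient F (x k w) = b%:R^-1 *: noise_sum f F P xi eta x0 k b w.
    have -> : noise_sum f F P xi eta x0 k b w = \sum_(i < b) sample_noise f F P xi eta x0 k i w.
      by apply: eq_bigl => i; exact: ltn_ord.
    rewrite big_split/= sumr_const card_ord scalerDr mulNrn scalerN -[gradient _ _ *+ _]scaler_nat scalerA.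
    by rewrite mulVf ?scale1r// pnatr_eq0 -lt0n.
  have d1R : 1 <= d%:R * ln 5 + 1 :> R.
    by rewrite lerDr mulr_ge0// ln_ge0// ler1n.
  have noise0 : 0 <= noise.
    by rewrite /noise /Bbar divr_ge0 ?ler0n// mulr_ge0 ?sqr_ge0.
  have sum_le : \sum_(k < T) enorm (g k - gradient F (x k w)) ^+ 2 <=
      noise * (T%:R * (d%:R * ln 5 + 1) + ell).
    (* The noise chain gives [T + ell]; [d ln 5 + 1 >= 1] brings it to the stated form. *)
    apply: (@le_trans _ _ (noise * (T%:R + ell))); last first.
      by rewrite ler_wpM2l// lerD2r ler_peMr.
    have b0R : 0 < b%:R :> R by rewrite ltr0n.
    have -> : \sum_(k < T) enorm (g k - gradient F (x k w)) ^+ 2 = energy w / b%:R ^+ 2.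
      rewrite /energy /noise_energy mulr_suml; apply: eq_bigr => k _.
      by rewrite gE enormZ exprMn enorm_sqr mulrC ger0_norm ?invr_ge0// exprVn.
    (* The factor [b^-2] comes from averaging the minibatch, and [noise / C] equals it exactly. *)
    have -> : energy w / b%:R ^+ 2 = noise * (energy w / C).
      rewrite CE /noise /Bbar -/b; field.
      by rewrite alpha_neq0 !gt_eqF.
    by rewrite ler_wpM2l.
  have xS k : x k.+1 w = x k w - (L * dr)^-1 *: (P k w *m (P k w)^T *m g k) by rewrite -eta_dr.
  have ma : 0 < m - a by rewrite subr_gt0.
  have := min_gradient_le F_diff F_smooth L_gt0 dr0 F_bounded (x := fun k => x k w) (g := g)
    (P := fun k => P k w) PP xS ma steps_ge sum_le.
  rewrite /good/= => /le_trans; apply; rewrite /bound -/m -/a.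
  (* The middle denominator is [(m - a) / T], so all three terms share the denominator [m - a] of
     [min_gradient_le]. *)
  have -> : Num.sqrt (2 * (mu / T%:R) * ell) = a / T%:R.
    have -> : 2 * (mu / T%:R) * ell = (a / T%:R) ^+ 2.
      by rewrite expr_div_n a2 /m; field; rewrite gt_eqF.
    by rewrite sqrtr_sqr ger0_norm// divr_ge0// ltW.
  have -> : mu - a / T%:R = (m - a) / T%:R by rewrite mulrBl /m mulfK// gt_eqF.
  rewrite (_ : F (x 0%N w) - inf (range F) = Delta0)// le_eqVlt; apply/orP; left; apply/eqP.
  by field; rewrite !gt_eqF.
have : (Pr (~` good) <= delta%:E)%E.
  apply: (le_trans (le_measure _ _ _ incl)); rewrite ?inE//.
  - exact: measurableC.
  - by do 2 apply: measurableU => //.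
  apply: le_trans (measureU2 _ _ _) _ => //; first exact: measurableU.
  rewrite [X in (_ + X)%E]bad3 adde0.
  apply: le_trans (measureU2 _ _ _) _ => //.
  apply: (@le_trans _ _ ((delta / 2)%:E + (delta / 2)%:E)%E).
    by rewrite -expell; exact: leeD.
  by rewrite -EFinD lee_fin; lra.
rewrite probability_setC// -(fineK (fin_num_measure Pr _ mgood)) -EFinB !lee_fin; lra.
Qed.
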